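(* Let $K$ be an algebraically closed field and let an algebraic group $G$ over $K$ act on a variety $X$ over $K$. If $X$ is irreducible, then there exists a dense Zariski open subset $X_1\subset X$ such that $$G\text{-mod}(x)\ \geq\ \dim X-\dim (G\cdot x)$$ for every $x\in X_1$.
   Context: Here $G\cdot x$ denotes the orbit of $x$. For a constructible subset $W\subset X$ and $x\in X$, $\dim_x W$ is the maximum of $\dim Z$ over the irreducible components $Z$ of $W$ containing $x$. For an open neighbourhood $U\subset X$ of $x$ put $U(i)=\{y\in U \mid \dim_y(U\cap G\cdot y)=i\}$ for $i\ge 0$, and $G\text{-mod}(U)=\max_{i\ge 0}\{\dim U(i)-i\}$. The modality of $x$ (in $X$) under $G$ is $G\text{-mod}(x)=\min\{G\text{-mod}(U)\mid U \text{ an open neighbourhood of } x\}$. *)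

(* Defs.v *)
From HB Require Import structures.
From mathcomp Require Import all_boot all_order all_algebra.
From mathcomp Require Import all_classical constructive_ereal topology.
From mathcomp Require mpoly.
(* The notations of mpoly clash with those of MathComp-Analysis. *)
Import -(notations) mpoly.

Set Implicit Arguments.
Unset Strict Implicit.
Unset Printing Implicit Defensive.

Import Order.TTheory GRing.Theory Num.Theory.

Local Open Scope classical_set_scope.
Local Open Scope ring_scope.

Section AffineSpace.
Context {K : closedFieldType} {n : nat}.

Definition peval (p : mpoly n K) (v : 'rV[K]_n) : K :=
  meval (fun i => v ord0 i) p.

Definition zeros (S : set (mpoly n K)) : set 'rV[K]_n :=
  [set v | forall p, S p -> peval p v = 0].

Definition algebraic_set (V : set 'rV[K]_n) := exists S, V = zeros S.

End AffineSpace.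

(* Varieties are described as by Weil and by Serre (FAC): a set of points
   together with a finite family of charts onto closed subsets of affine
   spaces. An atlas is only the data of such a family, on which nothing is
   required (see is_variety); chart i is meaningful on chart_dom i only. *)
Record atlas (K : closedFieldType) (T : choiceType) := Atlas {
  chart_index : finType;
  chart_dim : chart_index -> nat;
  chart_dom : chart_index -> set T;
  chart : forall i, T -> 'rV[K]_(chart_dim i)
}.

Definition zspace (K : closedFieldType) (T : choiceType) (A : atlas K T)
  : Type := T.

Section ZariskiTopology.
Context {K : closedFieldType} {T : choiceType} (A : atlas K T).

(* A subset is open when its trace on each chart is the inverse image of a
   Zariski open subset of the corresponding affine space. *)
Definition zariski_open : set_system (zspace A) :=
  [set W | forall i : chart_index A, exists S : set (mpoly (chart_dim i) K),
    chart_dom i `&` W = chart_dom i `\` chart i @^-1` zeros S].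

Lemma zariski_openT : zariski_open setT.
Proof.
move=> i; exists setT; rewrite setIT predeqE => x; split=> [ux|[]//].
split=> // /(_ (mpolyC _ 1) I); rewrite /peval mevalC.
by move/eqP; rewrite oner_eq0.
Qed.

Lemma zariski_openI : setI_closed zariski_open.
Proof.
move=> W1 W2 o1 o2 i; have [S1 e1] := o1 i; have [S2 e2] := o2 i.
exists [set r | exists p q, [/\ S1 p, S2 q & r = p * q]].
rewrite -[chart_dom i in LHS]setIid setIACA e1 e2 predeqE => x; split.
  move=> [[ux n1] [_ n2]]; split=> // z.
  have [p S1p /eqP p0] : exists2 p, S1 p & peval p (chart i x) <> 0.
    by apply: contrapT => h; apply: n1 => p Sp; apply: contrapT => ?; apply: h;
       exists p.
  apply: n2 => q S2q; have /eqP : peval (p * q) (chart i x) = 0.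
    by apply: z; exists p, q.
  by rewrite /peval mevalM mulf_eq0 (negbTE p0) => /eqP.
move=> [ux nz]; split; split=> // z; apply: nz => _ [p [q [S1p S2q ->]]];
  rewrite /peval mevalM.
- by have := z _ S1p; rewrite /peval => ->; rewrite mul0r.
- by have := z _ S2q; rewrite /peval => ->; rewrite mulr0.
Qed.

Lemma zariski_open_bigU (I : Type) (f : I -> set (zspace A)) :
  (forall j, zariski_open (f j)) -> zariski_open (\bigcup_j f j).
Proof.
move=> of_ i; have [S eS] := choice (fun j => of_ j i).
exists (\bigcup_j S j); rewrite setI_bigcupr predeqE => x; split.
  move=> [j _]; rewrite eS => -[ux nz]; split=> // z.
  by apply: nz => p Sp; apply: z; exists j.
move=> [ux nz]; apply: contrapT => h; apply: nz => p [j _ Sp].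
apply: contrapT => p0; apply: h; exists j => //; rewrite eS; split=> // z.
exact/p0/z.
Qed.

HB.instance Definition _ := Choice.copy (zspace A) T.
HB.instance Definition _ := isOpenTopological.Build (zspace A)
  zariski_openT zariski_openI zariski_open_bigU.

Lemma openZariskiE (W : set (zspace A)) : open W = zariski_open W.
Proof. by []. Qed.

(* Locally at x, f is a quotient of polynomials in the coordinates of every
   chart around x; on a variety, one chart around x suffices. *)
Definition regular_at (f : zspace A -> K) (x : zspace A) :=
  forall i : chart_index A, chart_dom i x -> exists p q : mpoly (chart_dim i) K,
    peval q (chart i x) <> 0 /\
    \forall y \near x, chart_dom i y ->
      f y = peval p (chart i y) / peval q (chart i y).

End ZariskiTopology.

(* A morphism is a continuous map pulling regular functions back to regular
   functions; as regularity is a local property, it is stated on germs. *)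
Definition is_morphism (K : closedFieldType) (T1 T2 : choiceType)
    (A : atlas K T1) (B : atlas K T2) (f : zspace A -> zspace B) :=
  continuous f /\
  forall x (h : zspace B -> K), regular_at h (f x) -> regular_at (h \o f) x.

(* The product of varieties, which carries the Zariski topology of the product
   charts and not the product topology. *)
Definition prod_atlas (K : closedFieldType) (T1 T2 : choiceType)
    (A : atlas K T1) (B : atlas K T2) : atlas K (T1 * T2)%type :=
  @Atlas K (T1 * T2)%type (chart_index A * chart_index B)%type
    (fun ij => chart_dim ij.1 + chart_dim ij.2)%N
    (fun ij => chart_dom ij.1 `*` chart_dom ij.2)
    (fun ij xy => row_mx (chart ij.1 xy.1) (chart ij.2 xy.2)).

Record is_variety (K : closedFieldType) (T : choiceType) (A : atlas K T)
    : Prop := IsVariety {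
  chart_cover : forall x : T, exists i : chart_index A, chart_dom i x;
  chart_open : forall i : chart_index A, open (chart_dom i : set (zspace A));
  chart_inj : forall i : chart_index A, set_inj (chart_dom i) (chart i);
  chart_image : forall i : chart_index A, algebraic_set (chart i @` chart_dom i);
  (* i.e. the changes of charts are regular *)
  chart_regular : forall (i : chart_index A) (k : 'I_(chart_dim i)) (x : zspace A),
    chart_dom i x -> regular_at (fun y : zspace A => chart i y ord0 k) x;
  variety_separated :
    closed ([set xy | xy.1 = xy.2] : set (zspace (prod_atlas A A)))
}.

Record variety (K : closedFieldType) := Variety {
  vpoints : choiceType;
  vatlas : atlas K vpoints;
  vatlasP : is_variety vatlas
}.

Definition variety_space (K : closedFieldType) (X : variety K) : topologicalType :=
  zspace (vatlas X).
Coercion variety_space : variety >-> topologicalType.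

Record algebraic_group (K : closedFieldType) := AlgebraicGroup {
  ag_group :> groupType;
  ag_atlas : atlas K ag_group;
  ag_variety : is_variety ag_atlas;
  ag_mul_morphism :
    @is_morphism K _ _ (prod_atlas ag_atlas ag_atlas) ag_atlas
      (fun gh => gh.1 * gh.2)%g;
  ag_inv_morphism : @is_morphism K _ _ ag_atlas ag_atlas (fun g => g^-1)%g
}.

Record algebraic_action (K : closedFieldType) (G : algebraic_group K)
    (X : variety K) (act : G -> X -> X) : Prop := AlgebraicAction {
  action1 : forall x, act 1%g x = x;
  actionM : forall g h x, act (g * h)%g x = act g (act h x);
  act_morphism :
    @is_morphism K _ _ (prod_atlas (ag_atlas G) (vatlas X)) (vatlas X)
      (fun gx => act gx.1 gx.2)
}.

Definition group_orbit (G X : Type) (act : G -> X -> X) (x : X) : set X :=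
  [set act g x | g in setT].

Section Dimension.
Context {T : topologicalType}.

Definition irreducible_set (Z : set T) :=
  Z !=set0 /\
  forall F1 F2, closed F1 -> closed F2 ->
    Z `<=` F1 `|` F2 -> Z `<=` F1 \/ Z `<=` F2.

Definition rel_closed (W Z : set T) := exists2 F, closed F & Z = W `&` F.

(* Z 0, ..., Z n is a strictly increasing chain of irreducible closed subsets
   of the subspace W; the values of Z beyond n are irrelevant. *)
Definition irreducible_chain (W : set T) (n : nat) (Z : nat -> set T) :=
  (forall k, (k <= n)%N -> irreducible_set (Z k) /\ rel_closed W (Z k)) /\
  (forall k, (k < n)%N -> Z k `<` Z k.+1).

(* Krull dimension of the subspace W, the empty set having dimension -oo.
   Dimensions take their values in \bar int, where all suprema exist. *)
Definition krull_dim (W : set T) : \bar int :=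
  supremum -oo%E
    [set n%:Z%:E | n in [set n : nat | exists Z, irreducible_chain W n Z]].

Definition irreducible_component (W Z : set T) :=
  [/\ irreducible_set Z, Z `<=` W &
      forall Z', irreducible_set Z' -> Z `<=` Z' -> Z' `<=` W -> Z' = Z].

Definition dim_at (x : T) (W : set T) : \bar int :=
  supremum -oo%E
    [set krull_dim Z | Z in [set Z | irreducible_component W Z /\ Z x]].

End Dimension.

Section Modality.
Context {K : closedFieldType} {G : algebraic_group K} {X : variety K}.
Variable act : G -> X -> X.

Definition orbit_stratum (U : set X) (i : nat) : set X :=
  [set y | U y /\ dim_at y (U `&` group_orbit act y) = i%:Z%:E].

Definition modality_on (U : set X) : \bar int :=
  supremum -oo%E
    [set (krull_dim (orbit_stratum U i) - i%:Z%:E)%E | i in [set: nat]].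

Definition modality (x : X) : \bar int :=
  infimum +oo%E [set modality_on U | U in [set U : set X | open U /\ U x]].

End Modality.

(* Main.v *)
Require Import Defs.
From HB Require Import structures.
From mathcomp Require Import all_boot all_order all_algebra.
From mathcomp Require Import all_classical constructive_ereal topology.
From mathcomp Require Import zify ring.
From mathcomp Require mpoly.
Import -(notations) mpoly.

Set Implicit Arguments.
Unset Strict Implicit.
Unset Printing Implicit Defensive.

Import Order.TTheory GRing.Theory Num.Theory.

Local Open Scope classical_set_scope.
Local Open Scope ring_scope.

(** The proof rests on one fact: there are a number [d] and a nonempty open set
    [X1] such that [dim_y (U `&` G.y) = d] for all [y] in [X1] and all open [U]
    around [y]. Given this, let [x] be in [X1] and [U] an open neighbourhood of
    [x]. The stratum [U(d)] contains the nonempty open subset [U `&` X1] of the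
    irreducible space [X], hence has the dimension of [X], while [d] is at most
    [dim G.x] because [d] is the dimension of a part of [G.x]. So the modality
    of [U] is at least [dim X - d >= dim X - dim G.x].

    Krull dimensions are computed by counting algebraically independent
    functions. A chain of irreducible closed sets of length [n] yields [n]
    functions that are independent on its largest member: take one that
    vanishes on each member but not on the next ([indep_of_chain],
    [chain_independent]). Conversely, let [t_0, ..., t_(d-1)] be independent on
    an irreducible affine set. Imposing [t_(d-1) = c], then [t_(d-2) = c'], and
    so on, for suitable constants produces a chain of length [d], all of whose
    members meet a prescribed principal open set ([slice_chain],
    [fiber_chain]). A slice with the right properties exists because the image
    of a dominant map to affine space contains a principal open set
    ([image_contains_open]), which is shown by eliminating one coordinate at a
    time ([extend_point]). When the [t_k] are composed of an orbit map and of
    functions on [X], the members of the chain are still told apart by the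
    values of these functions on [X], so their images form a chain in the
    orbit; likewise the slices of a chart of [X] give chains of length [dim X]
    in every nonempty open subset of [X].

    That functions algebraic over [d] of them contain no more than [d]
    independent ones is proved by counting: after multiplication by a power of
    a fixed denominator, the monomials of degree at most [M] lie in a space of
    dimension [O(M^d)] ([growth_algebraic], [growth_bound]).

    It remains to see that the number of independent functions on the orbit of
    [x] does not depend on [x], for [x] generic ([generic_rank]). The
    coordinates of [g.x] are rational functions [F] of [(g, x)]. Among all
    coordinates of [(g, x, g.x)], extend a maximal independent set [B0] of
    [x]-coordinates first by a set [Phi] of coordinates of [g.x] and then by a
    set [Theta] of [g]-coordinates, maximally each time. The algebraic
    relations of the other coordinates over these ones specialise at a generic
    [x]. On the one hand, [F(., x)] is then algebraic over [Phi], so there are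
    at most [#|Phi|] independent functions on the orbit. On the other hand, the
    [g]-coordinates are then algebraic over [Phi] and [Theta], whose number is
    at most the number of independent [g]-coordinates, so that [Phi] and
    [Theta] must remain independent at [x]. *)

(** * Polynomials in a sequence of values *)

Section Evaluation.
Context {K : closedFieldType}.
Implicit Types (n m : nat) (v w : nat -> K).

(** Points are sequences of values, of which a polynomial in [n] variables reads
    the first [n] terms: polynomials in different numbers of variables can then
    be evaluated at the same point. *)
Definition ev v n (P : mpoly n K) : K := meval (fun i : 'I_n => v i) P.

HB.instance Definition _ v n := GRing.RMorphism.copy (@ev v n)
  (meval (fun i : 'I_n => v i)).

Lemma evC v n (c : K) : ev v (mpolyC n c) = c.
Proof. exact: mevalC. Qed.

Lemma evZ v n c (P : mpoly n K) : ev v (c *: P) = c * ev v P.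
Proof. exact: mevalZ. Qed.

Lemma evX v n (i : 'I_n) : ev v (mpolyX K (mnm1 i)) = v i.
Proof. exact: mevalXU. Qed.

Lemma evXm v n (m : multinom n) : ev v (mpolyX K m) = \prod_(i < n) v i ^+ m i.
Proof. exact: mevalX. Qed.

Lemma evE v n (P : mpoly n K) :
  ev v P = \sum_(m <- msupp P) mcoeff m P * \prod_(i < n) v i ^+ m i.
Proof. exact: mevalE. Qed.

Lemma eq_ev v w n (P : mpoly n K) :
  (forall i, (i < n)%N -> v i = w i) -> ev v P = ev w P.
Proof. by move=> e; apply: meval_eq => i; apply: e. Qed.

Lemma ev_muni v n (P : mpoly n.+1 K) :
  ev v P = (map_poly (@ev v n) (muni P)).[v n].
Proof.
rewrite muniE evE raddf_sum /= horner_sum; apply: eq_bigr => m _.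
rewrite -mul_polyC -mul_mpolyC rmorphM /= map_polyC /= map_polyXn.
rewrite rmorphM /= evC evXm hornerM hornerXn hornerC -mulrA big_ord_recr /=.
congr (_ * (_ * _)); apply: eq_bigr => i _; rewrite mnmE /=.
by congr (_ ^+ m _); apply: val_inj.
Qed.

(** No cancellation occurs: distinct monomials differ in their exponent of the
    last variable or in the remaining part. *)
Lemma muni_eq0 n (P : mpoly n.+1 K) : (muni P == 0) = (P == 0).
Proof.
apply/idP/idP => [/eqP m0|/eqP->]; last by rewrite raddf0.
apply: contraTT isT => Pn0.
have /hasP[m0' mP _] : has predT (msupp P).
  by rewrite has_predT lt0n size_eq0 msupp_eq0.
have := m0; rewrite muniE => /(congr1 (fun q : {poly mpoly n K} => q`_(m0' ord_max))).
rewrite coef0 coef_sum.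
move=> /(congr1 (mcoeff (Multinom [tuple m0' (widen_ord (leqnSn n) i) | i < n]))).
rewrite raddf0 raddf_sum (bigD1_seq m0') //= big1 ?addr0.
  rewrite !coefZ coefXn eqxx mulr1 mcoeffZ mcoeffX eqxx mulr1 => /eqP.
  by rewrite mcoeff_eq0 mP.
move=> m mm0; rewrite coefZ coefXn; case: eqP => [e|]; last by rewrite mulr0 raddf0.
rewrite mulr1 mcoeffZ mcoeffX; case: eqP => [e'|]; last by rewrite mulr0.
case/eqP: mm0; apply/mnmP => i.
case: (unliftP ord_max i) => [j ->|-> //].
have := congr1 (fun mm : multinom n => mm j) e'; rewrite !mnmE /=.
by have -> : lift ord_max j = widen_ord (leqnSn n) j; first exact/val_inj/lift_max.
Qed.

Lemma upoly_ev_neq0 n (q : {poly mpoly n K}) :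
  (forall P : mpoly n K, P != 0 -> exists v, ev v P != 0) -> q != 0 ->
  exists v, (map_poly (@ev v n) q).[v n] != 0.
Proof.
move=> IH; rewrite -lead_coef_eq0 => /IH[v lv].
have : map_poly (@ev v n) q != 0.
  by apply: contra_neq lv => e; rewrite lead_coefE -coef_map e coef0.
move=> /closed_nonrootP[c nr].
exists (fun i => if i == n then c else v i); rewrite eqxx.
rewrite (_ : map_poly _ _ = map_poly (@ev v n) q) //.
by apply: eq_map_poly => Q; apply: eq_ev => i; rewrite ltn_neqAle => /andP[/negbTE->].
Qed.

(** A nonzero polynomial has a nonzero value, as [K] is infinite: by induction
    the leading coefficient with respect to the last variable is nonzero
    somewhere, and there the univariate polynomial has finitely many roots. *)
Lemma ev_neq0 n (P : mpoly n K) : P != 0 -> exists v, ev v P != 0.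
Proof.
elim: n P => [P|n IH P].
  move=> Pn0; exists (fun=> 0); apply: contra_neq Pn0 => e; apply/mpolyP => m.
  move: e; rewrite evE mcoeff0; have [|mP _] := boolP (m \in msupp P).
    move=> mP; rewrite (bigD1_seq m) //= big_ord0 mulr1 big1 ?addr0 //.
    by move=> m' /eqP[]; apply/mnmP => -[].
  by move: mP; rewrite mcoeff_msupp negbK => /eqP.
rewrite -muni_eq0 => /(upoly_ev_neq0 IH)[v nz].
by exists v; rewrite ev_muni.
Qed.

(** Handling polynomials as functions spares explicit substitutions; nothing is
    lost, since [K] is infinite. *)
Definition polyfn n (f : (nat -> K) -> K) := exists P : mpoly n K, forall v, f v = ev v P.

Lemma polyfn_ev n (P : mpoly n K) : polyfn n (fun v => ev v P).
Proof. by exists P. Qed.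

Lemma polyfnC n (c : K) : polyfn n (fun=> c).
Proof. by exists (mpolyC n c) => v; rewrite evC. Qed.

Lemma polyfnX n i : (i < n)%N -> polyfn n (fun v => v i).
Proof. by move=> lt; exists (mpolyX K (mnm1 (Ordinal lt))) => v; rewrite evX. Qed.

Lemma polyfnM n f g : polyfn n f -> polyfn n g -> polyfn n (fun v => f v * g v).
Proof. by move=> [P eP] [Q eQ]; exists (P * Q) => v; rewrite rmorphM eP eQ. Qed.

Lemma polyfnXn n f k : polyfn n f -> polyfn n (fun v => f v ^+ k).
Proof. by move=> [P eP]; exists (P ^+ k) => v; rewrite rmorphXn eP. Qed.

Lemma polyfn_sum n (I : Type) (r : seq I) (F : I -> (nat -> K) -> K) :
  (forall i, polyfn n (F i)) -> polyfn n (fun v => \sum_(i <- r) F i v).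
Proof.
move=> /choice[P eP]; exists (\sum_(i <- r) P i) => v.
by rewrite rmorph_sum; apply: eq_bigr => i _; apply: eP.
Qed.

Lemma polyfn_prod n (I : Type) (r : seq I) (F : I -> (nat -> K) -> K) :
  (forall i, polyfn n (F i)) -> polyfn n (fun v => \prod_(i <- r) F i v).
Proof.
move=> /choice[P eP]; exists (\prod_(i <- r) P i) => v.
by rewrite rmorph_prod; apply: eq_bigr => i _; apply: eP.
Qed.

Lemma polyfn_comp n m (P : mpoly m K) (r : nat -> (nat -> K) -> K) :
  (forall i, (i < m)%N -> polyfn n (r i)) ->
  polyfn n (fun v => ev (fun i => r i v) P).
Proof.
move=> rP; under [X in polyfn n X]funext => v do rewrite evE.
by apply: polyfn_sum => mm; apply: polyfnM; [exact: polyfnC|];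
   apply: polyfn_prod => i; apply: polyfnXn; apply: rP.
Qed.

End Evaluation.

(** * Noetherianity and irreducible decomposition *)

Section Noetherian.

Definition comb (R : comNzRingType) (p : nat -> R) k x :=
  exists c : nat -> R, x = \sum_(i < k) c i * p i.

Definition noetherian_ring (R : comNzRingType) :=
  forall p : nat -> R, exists k, comb p k (p k).

Context {R : comNzRingType}.
Implicit Types (p : nat -> R) (x y : R).

Lemma combD p k x y : comb p k x -> comb p k y -> comb p k (x + y).
Proof.
move=> [c ->] [d ->]; exists (fun i => c i + d i); rewrite -big_split.
by apply: eq_bigr => i _; rewrite mulrDl.
Qed.

Lemma combM p k a x : comb p k x -> comb p k (a * x).
Proof.
move=> [c ->]; exists (fun i => a * c i); rewrite mulr_sumr.
by apply: eq_bigr => i _; rewrite mulrA.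
Qed.

Lemma comb_sum p k (c f : nat -> R) m :
  (forall i, (i < m)%N -> comb p k (f i)) -> comb p k (\sum_(i < m) c i * f i).
Proof.
elim: m => [_|m IH fP].
  by rewrite big_ord0; exists (fun=> 0); rewrite big1 // => i _; rewrite mul0r.
rewrite big_ord_recr; apply: combD; last by apply: combM; apply: fP.
by apply: IH => i im; apply: fP; apply: ltnW.
Qed.

Lemma comb_leq p k l x : (k <= l)%N -> comb p k x -> comb p l x.
Proof.
move=> kl [c ->]; exists (fun i => if (i < k)%N then c i else 0).
rewrite (big_ord_widen l (fun i => c i * p i) kl) big_mkcond /=.
by apply: eq_bigr => i _; case: ifP => // _; rewrite mul0r.
Qed.

Lemma comb_gen p k i : (i < k)%N -> comb p k (p i).
Proof.
move=> ik; exists (fun j => (j == i)%:R); rewrite (bigD1 (Ordinal ik)) //= eqxx mul1r.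
by rewrite big1 ?addr0 // => j; rewrite -val_eqE /= => /negbTE->; rewrite mul0r.
Qed.

End Noetherian.

(** Otherwise one can choose successively elements [f k] of the ideal generated
    by the sequence [p], each of least size among those outside the ideal of its
    predecessors. Some leading coefficient is a combination of the preceding
    ones, and cancelling it yields an element of smaller size. *)
Lemma noetherian_poly (R : comNzRingType) : noetherian_ring R -> noetherian_ring {poly R}.
Proof.
move=> nR p; apply: contrapT => /forallNP np.
pose I x := exists k, comb p k x.
have Iall (s : nat -> {poly R}) m : (forall i, (i < m)%N -> I (s i)) ->
    exists k, forall i, (i < m)%N -> comb p k (s i).
  elim: m => [_|m IH sI]; first by exists 0%N.
  have [|k kP] := IH; first by move=> i im; apply: sI; apply: ltnW.
  have [l lP] := sI m (ltnSn m); exists (maxn k l) => i.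
  rewrite ltnS leq_eqVlt => /predU1P[->|im].
    by apply: comb_leq lP; apply: leq_maxr.
  by apply: comb_leq (kP _ im); apply: leq_maxl.
pose spn (s : seq {poly R}) x := comb (fun i => s`_i) (size s) x.
have /choice[pick pickP] : forall s : seq {poly R}, exists x,
    (forall i, (i < size s)%N -> I s`_i) ->
    [/\ I x, ~ spn s x & forall y, I y -> ~ spn s y -> (size x <= size y)%N].
  move=> s; have [sI|] := pselect (forall i, (i < size s)%N -> I s`_i);
    last by exists 0.
  have [k kP] := Iall _ _ sI.
  have ex : exists n, `[< exists x, [/\ I x, ~ spn s x & size x = n] >].
    exists (size (p k)); apply/asboolP; exists (p k); split=> //.
      by exists k.+1; apply: comb_gen.
    by move=> [c e]; apply: (np k); rewrite e; apply: comb_sum.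
  case: (ex_minnP ex) => n /asboolP[x [Ix nx sx]] nmin.
  exists x => _; split=> // y Iy ny; rewrite sx; apply: nmin; apply/asboolP.
  by exists y.
pose S := fix S k := if k is k'.+1 then rcons (S k') (pick (S k')) else [::].
pose f k := pick (S k).
have SE k : S k = mkseq f k by elim: k => // k IH; rewrite mkseqS -IH.
have spnE k x : spn (S k) x <-> comb f k x.
  rewrite /spn SE size_mkseq; split=> -[c ->]; exists c; apply: eq_bigr => i _;
  by rewrite nth_mkseq.
have fP k : [/\ I (f k), ~ comb f k (f k) &
    forall y, I y -> ~ comb f k y -> (size (f k) <= size y)%N].
  elim/ltn_ind: k => k IH.
  have [|Ix nx xmin] := pickP (S k).
    by move=> i; rewrite SE size_mkseq => ik; rewrite nth_mkseq //; case: (IH i ik).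
  by split=> // [/spnE//|y Iy ny]; apply: xmin => // /spnE.
have [k [c ek]] := nR (fun k => lead_coef (f k)).
have [Ik nk kmin] := fP k.
have fk0 : f k != 0.
  by apply: contra_not_neq nk => ->; exists (fun=> 0); rewrite big1 // => i _; rewrite mul0r.
have szf i : (i < k)%N -> (size (f i) <= size (f k))%N.
  move=> ik; have [_ _] := fP i; apply=> //.
  by apply: contra_not nk => /comb_leq; apply; apply: ltnW.
(* The leading terms cancel. *)
pose g := f k - \sum_(i < k) ((c i)%:P * 'X^(size (f k) - size (f i))) * f i.
have sg : (size g < size (f k))%N.
  rewrite -(prednK (n := size (f k))) ?size_poly_gt0 // ltnS.
  apply/leq_sizeP => j; rewrite leq_eqVlt => /predU1P[<-|].
    rewrite coefB coef_sum; apply/eqP; rewrite subr_eq0; apply/eqP.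
    rewrite -lead_coefE ek; apply: eq_bigr => i _.
    rewrite -mulrA coefCM coefXnM.
    have sik := szf i (ltn_ord i).
    have [f0|fi0] := eqVneq (f i) 0; first by rewrite f0 lead_coef0 coef0 if_same !mulr0.
    have si : (0 < size (f i))%N by rewrite size_poly_gt0.
    have sk : (0 < size (f k))%N by rewrite size_poly_gt0.
    rewrite ifF; last by apply/negbTE; rewrite -leqNgt; lia.
    by rewrite lead_coefE; congr (_ * _`_ _); lia.
  rewrite prednK ?size_poly_gt0 // => kj.
  rewrite coefB coef_sum nth_default // sub0r big1 ?oppr0 // => i _.
  rewrite -mulrA coefCM coefXnM; case: ifP => [_|_]; first by rewrite mulr0.
  rewrite nth_default ?mulr0 //; move: (szf i (ltn_ord i)) kj.
  move: (size (f i)) (size (f k)) => a b ab bj; lia.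
suff : (size (f k) <= size g)%N by rewrite leqNgt sg.
apply: kmin.
  have [l lP] := Iall f k.+1 (fun i _ => let: And3 Ii _ _ := fP i in Ii).
  exists l; rewrite /g -mulN1r; apply: combD; first exact: lP.
  apply: combM.
  apply: (@comb_sum _ p l (fun i => (c i)%:P * 'X^(size (f k) - size (f i))) f k).
  by move=> i ik; apply: lP; apply: ltnW.
move=> ng; apply: nk; rewrite (_ : f k = g +
    \sum_(i < k) ((c i)%:P * 'X^(size (f k) - size (f i))) * f i);
  last by rewrite subrK.
apply: combD => //.
apply: (@comb_sum _ f k (fun i => (c i)%:P * 'X^(size (f k) - size (f i))) f k).
by move=> i ik; apply: comb_gen.
Qed.

Section ZeroSets.
Context {K : closedFieldType}.
Implicit Types (n : nat) (v w : nat -> K).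

Lemma horner_map_ev v n (q : {poly mpoly n K}) c :
  (map_poly (@ev K v n) q).[c] = \sum_(i < size q) ev v q`_i * c ^+ i.
Proof.
rewrite (horner_coef_wide _ (size_poly _ _)).
by apply: eq_bigr => i _; rewrite coef_map.
Qed.

Lemma muni_surj n (q : {poly mpoly n K}) : exists P : mpoly n.+1 K, muni P = q.
Proof.
have [P eP] : polyfn n.+1 (fun v => (map_poly (@ev K v n) q).[v n]).
  under [X in polyfn _ X]funext => v do rewrite horner_map_ev.
  apply: polyfn_sum => i; apply: polyfnM; last by apply/polyfnXn/polyfnX.
  have := @polyfn_comp K n.+1 n q`_i (fun i v => v i); apply=> j jn.
  by apply: polyfnX; apply: ltnW.
exists P; apply/eqP; rewrite -subr_eq0; apply: contraT.
move=> /(upoly_ev_neq0 (@ev_neq0 K n))[v]; rewrite raddfB /= hornerD hornerN.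
by rewrite eP ev_muni subrr eqxx.
Qed.

Lemma mpoly0E (P : mpoly 0 K) : P = mpolyC 0 (ev (fun=> 0) P).
Proof.
apply/eqP; rewrite -subr_eq0; apply: contraT => /ev_neq0[v].
by rewrite rmorphB /= evC (@eq_ev _ v (fun=> 0)) ?subrr ?eqxx.
Qed.

(** Hilbert's basis theorem. *)
Lemma noetherian_mpoly n : noetherian_ring (mpoly n K).
Proof.
elim: n => [p|n IH p].
  have [p0|p0] := eqVneq (p 0%N) 0.
    by exists 0%N, (fun=> 0); rewrite big_ord0.
  exists 1%N, (fun=> p 1%N * mpolyC 0 (ev (fun=> 0) (p 0%N))^-1).
  rewrite big_ord1 -mulrA [p 0%N in X in _ * X]mpoly0E -mpolyCM evC mulVf ?mulr1 //.
  by apply: contra_neq p0 => e; rewrite [LHS]mpoly0E e mpolyC0.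
have [k [c ek]] := noetherian_poly IH (fun k => muni (p k)).
have /choice[d dP] := fun i => muni_surj (c i).
exists k, d; apply/eqP; rewrite -subr_eq0 -muni_eq0 muniB (raddf_sum (@muni n K)) /= ek subr_eq0.
by apply/eqP; apply: eq_bigr => i _; rewrite muniM dP.
Qed.

Context {T : Type} (n : nat) (y : T -> nat -> K).
Implicit Types (Z A W : set T).

(** In what follows, [y] gives coordinates on a set [Z] of points of any type [T].
    The first [n] coordinates map [Z] to affine space: [prime_on] says that the
    closure of the image is irreducible, [closed_on] that the image is closed. *)
Definition vanish Z (P : mpoly n K) := forall z, Z z -> ev (y z) P = 0.

Definition prime_on Z := Z !=set0 /\ forall P Q, vanish Z (P * Q) -> vanish Z P \/ vanish Z Q.

Definition closed_on Z := forall v, (forall P, vanish Z P -> ev v P = 0) ->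
  exists2 z, Z z & forall i, (i < n)%N -> y z i = v i.

Definition cut Z (S : set (mpoly n K)) : set T :=
  [set z | Z z /\ forall P, S P -> ev (y z) P = 0].

Lemma closed_on_cut Z S : closed_on Z -> closed_on (cut Z S).
Proof.
move=> cZ v vP; have [|z Zz zv] := cZ v.
  by move=> P VP; apply: vP => z [Zz _]; apply: VP.
exists z => //; split=> // P SP; rewrite (eq_ev (w := v)) //.
by apply: vP => z' [_]; apply.
Qed.

(** If [Z] had no such decomposition, cutting it repeatedly by polynomials [next]
    that do not vanish on the part at hand would produce an infinite strictly
    decreasing sequence of closed subsets. *)
Lemma irreducible_decomposition Z : exists r (A : nat -> set T),
  (forall i, (i < r)%N -> prime_on (A i) /\ exists S, A i = cut Z S) /\
  forall z, Z z <-> exists2 i, (i < r)%N & A i z.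
Proof.
pose good Z := exists r (A : nat -> set T),
  (forall i, (i < r)%N -> prime_on (A i) /\ exists S, A i = cut Z S) /\
  forall z, Z z <-> exists2 i, (i < r)%N & A i z.
change (good Z); apply: contrapT => badZ.
have cutU W P S : cut (cut W [set P]) S = cut W (P |` S).
  apply/seteqP; split=> z /=; rewrite /cut /=.
    by move=> [[Wz Pz] Sz]; split=> // Q [->|]; [exact: Pz|exact: Sz].
  move=> [Wz h]; split; last by move=> Q SQ; apply: h; right.
  by split=> // Q ->; apply: h; left.
have step W : ~ good W -> exists P, ~ vanish W P /\ ~ good (cut W [set P]).
  move=> badW; apply: contrapT => noP; apply: badW.
  have [[z0 Wz0]|W0] := pselect (W !=set0); last first.
    exists 0%N, (fun=> set0); split=> // z; split=> [Wz|[]//].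
    by case: W0; exists z.
  have [pW|npW] := pselect (prime_on W).
    exists 1%N, (fun=> W); split=> [i _|z]; last by split=> [Wz|[]//]; exists 0%N.
    split=> //; exists set0; apply/seteqP; split=> z /=; last by case.
    by split.
  have [P [Q [PQ nP nQ]]] : exists P Q,
      [/\ vanish W (P * Q), ~ vanish W P & ~ vanish W Q].
    apply: contrapT => h; apply: npW; split; first by exists z0.
    move=> P Q PQ; apply: contrapT => /not_orP[nP nQ].
    by apply: h; exists P, Q.
  have [r [A [Ap Ae]]] : good (cut W [set P]).
    by apply: contrapT => nG; apply: noP; exists P.
  have [s [B [Bp Be]]] : good (cut W [set Q]).
    by apply: contrapT => nG; apply: noP; exists Q.
  exists (r + s)%N, (fun i => if (i < r)%N then A i else B (i - r)%N); split.
    move=> i irs; case: ifP => ir.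
      have [pA [S eS]] := Ap i ir; split=> //.
      by exists (P |` S); rewrite eS cutU.
    have [|pB [S eS]] := Bp (i - r)%N; first by lia.
    by split=> //; exists (Q |` S); rewrite eS cutU.
  move=> z; split=> [Wz|[i irs]].
    have /eqP := PQ z Wz; rewrite rmorphM mulf_eq0 => /orP[]/eqP z0'.
      have [i ir Ai] : exists2 i, (i < r)%N & A i z.
        by apply/Ae; split=> // _ ->.
      by exists i; rewrite ?ir //; lia.
    have [i ir Bi] : exists2 i, (i < s)%N & B i z.
      by apply/Be; split=> // _ ->.
    exists (r + i)%N; first by lia.
    by rewrite ifF ?addKn //; apply/negbTE; rewrite -leqNgt leq_addr.
  case: ifP => ir z1.
    by have [] : cut W [set P] z by apply/Ae; exists i.
  have [] // : cut W [set Q] z by apply/Be; exists (i - r)%N => //; lia.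
(* [next W] does not vanish on [W], and cutting [W] by it leaves a set without
   decomposition. *)
have /choice[next nextP] : forall W, exists P, ~ good W ->
    ~ vanish W P /\ ~ good (cut W [set P]).
  move=> W; have [gW|/step[P PP]] := pselect (good W); first by exists 0.
  by exists P.
pose W := fix W k := if k is k'.+1 then cut (W k') [set next (W k')] else Z.
have bW k : ~ good (W k) by elim: k => // k /nextP[].
have zW k i z : (i < k)%N -> W k z -> ev (y z) (next (W i)) = 0.
  elim: k => // k IH; rewrite ltnS leq_eqVlt => /predU1P[->|ik] [Wz h].
    exact: h.
  exact: IH.
have [k [c ek]] := noetherian_mpoly (fun k => next (W k)).
have [nv _] := nextP _ (bW k); apply: nv => z Wz.
rewrite ek rmorph_sum big1 //= => i _; rewrite rmorphM /=.
by rewrite (zW k i) ?mulr0.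
Qed.

End ZeroSets.

(** * Images and slices of irreducible affine sets *)

(** Elimination of the last of [m.+1] coordinates. Univariate polynomials with
    coefficients in the first [m] coordinates are evaluated by [uv]; [I] is the
    ideal of those that vanish on [Z], [J] is the ideal of polynomials in the
    first [m] coordinates that vanish on [Z], and [Jc] holds for polynomials all
    of whose coefficients lie in [J]. *)
Section Extension.
Context {K : closedFieldType} {T : Type} (m : nat) (y : T -> nat -> K) (Z : set T).
Hypothesis pZ : prime_on m.+1 y Z.
Implicit Types (p q r h : {poly mpoly m K}) (P : mpoly m K).

Let uv v c q : K := (map_poly (@ev K v m) q).[c].
Let I q := forall z, Z z -> uv (y z) (y z m) q = 0.
Let J P := vanish y Z P.
Let Jc q := forall i, J q`_i.

Let uvD v c p q : uv v c (p + q) = uv v c p + uv v c q.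
Proof. by rewrite /uv rmorphD hornerD. Qed.
Let uvB v c p q : uv v c (p - q) = uv v c p - uv v c q.
Proof. by rewrite /uv rmorphB hornerD hornerN. Qed.
Let uvM v c p q : uv v c (p * q) = uv v c p * uv v c q.
Proof. by rewrite /uv rmorphM hornerM. Qed.
Let uvC v c P : uv v c P%:P = ev v P.
Proof. by rewrite /uv map_polyC hornerC. Qed.
Let uvZ v c P q : uv v c (P *: q) = ev v P * uv v c q.
Proof. by rewrite -mul_polyC uvM uvC. Qed.

Let IM p q : I (p * q) -> I p \/ I q.
Proof.
have [P eP] := muni_surj p; have [Q eQ] := muni_surj q.
have IE R : I (muni R) <-> vanish y Z R.
  by split=> H z /H; rewrite ev_muni.
by rewrite -eP -eQ -muniM => /IE/pZ.2[] /IE; [left|right].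
Qed.

Let IC P : I P%:P <-> J P.
Proof. by split=> H z /H; rewrite uvC. Qed.

Let Iadd p q : I p -> I q -> I (p + q).
Proof. by move=> Ip Iq z Zz; rewrite uvD Ip ?Iq ?addr0. Qed.
Let Isub p q : I p -> I q -> I (p - q).
Proof. by move=> Ip Iq z Zz; rewrite uvB Ip ?Iq ?subr0. Qed.
Let Imul p q : I q -> I (p * q).
Proof. by move=> Iq z Zz; rewrite uvM Iq ?mulr0. Qed.

Let J0 : J 0.
Proof. by move=> z _; rewrite rmorph0. Qed.

Let JM P Q : J (P * Q) -> J P \/ J Q.
Proof. by rewrite -!IC polyCM => /IM. Qed.

Let JXn P k : J (P ^+ k) -> J P.
Proof.
elim: k => [|k IH]; rewrite ?exprS; last by case/JM.
have [z Zz] := pZ.1; move=> /(_ z Zz) /eqP; rewrite expr0 rmorph1 oner_eq0 //.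
Qed.

Let uvJ v c q : (forall P, J P -> ev v P = 0) -> Jc q -> uv v c q = 0.
Proof.
move=> vJ Jq; rewrite /uv horner_map_ev big1 // => i _.
by rewrite (vJ _ (Jq i)) mul0r.
Qed.

Let JcI q : Jc q -> I q.
Proof. by move=> Jq z Zz; apply: uvJ => // P; apply. Qed.

Let JcD p q : Jc p -> Jc q -> Jc (p + q).
Proof.
by move=> Jp Jq i z Zz; rewrite coefD rmorphD /= [X in X + _]Jp // Jq // addr0.
Qed.

Let strip q : ~ Jc q -> exists q', [/\ ~ J (lead_coef q'), (size q' <= size q)%N &
  Jc (q - q')].
Proof.
have [n] := ubnP (size q); elim: n q => // n IH q; rewrite ltnS => sq nJ.
have [Jl|nJl] := pselect (J (lead_coef q)); last first.
  by exists q; split=> // i; rewrite subrr coef0.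
have q0 : q != 0 by apply: contra_not_neq nJ => -> i; rewrite coef0.
pose q1 := q - lead_coef q *: 'X^((size q).-1).
have sq0 : (0 < size q)%N by rewrite size_poly_gt0.
have sq1 : (size q1 < size q)%N.
  rewrite -(prednK sq0) ltnS; apply/leq_sizeP => j; rewrite leq_eqVlt.
  rewrite coefB coefZ coefXn => /predU1P[<-|].
    by rewrite eqxx mulr1 lead_coefE subrr.
  move=> lj; rewrite gtn_eqF // mulr0 subr0 nth_default //.
  by rewrite -(prednK sq0).
have Jd : Jc (q - q1).
  move=> i; rewrite opprB addrC subrK coefZ coefXn.
  by case: eqP => _; rewrite ?mulr1 // mulr0.
have [|//|q' [nl sq' Jq']] := IH q1.
- exact: leq_trans sq1 sq.
- by move=> Jq1; apply: nJ; rewrite -(subrK q1 q); apply: JcD.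
exists q'; split=> //; first exact: leq_trans sq' (ltnW sq1).
by rewrite -(subrK q1 q) -addrA; apply: JcD.
Qed.

(** If [I] consists of polynomials with coefficients in [J], any value of the last
    coordinate is admissible, and some coefficient of [h] serves as [b].
    Otherwise let [p] be an element of [I] of least size whose leading coefficient
    [l] is not in [J]. Pseudo-division by [p] shows that a root of [p] above a
    point where [l] is nonzero is a zero of all of [I]. Moreover [I] and [h]
    together generate a nonzero constant [b0] modulo [J], again by
    pseudo-division, so that [h] is nonzero where [l * b0] is. *)
Lemma extend_point h : ~ I h -> exists b, ~ J b /\
  forall v, (forall P, J P -> ev v P = 0) -> ev v b != 0 ->
  exists c, (forall q, I q -> uv v c q = 0) /\ uv v c h != 0.
Proof.
move=> nh; have [IJ|] := pselect (forall q, I q -> Jc q).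
  have [i nJ] : exists i, ~ J h`_i.
    by apply: contrapT => /forallNP H; apply: nh; apply: JcI => i; apply: contrapT.
  exists h`_i; split=> // v vJ hv.
  have /closed_nonrootP[c nc] : map_poly (@ev K v m) h != 0.
    by apply: contra_neq hv => e; rewrite -[LHS]/(ev v _) -coef_map e coef0.
  by exists c; split=> [q Iq|]; [apply: uvJ => //; apply: IJ|exact: nc].
move=> /existsNP[q0 /not_implyP[Iq0 nJq0]].
have exp : exists n, `[< exists p, [/\ I p, ~ J (lead_coef p) & size p = n] >].
  have [p [nl _ Jd]] := strip nJq0; exists (size p); apply/asboolP; exists p.
  split=> //; rewrite -(subKr q0 p); apply: Isub => //.
  exact: JcI.
case: (ex_minnP exp) => n /asboolP[p [Ip nJp sp]] nmin.
(* Terms with coefficients in [J] do not count, so minimality of [p] concerns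
   all elements of [I]. *)
have Min q : I q -> (size q < size p)%N -> Jc q.
  move=> Iq sq; apply: contrapT => /strip[q' [nl sq' Jd]].
  have : (n <= size q')%N.
    apply: nmin; apply/asboolP; exists q'; split=> //.
    by rewrite -(subKr q q'); apply: Isub => //; exact: JcI.
  by rewrite -sp leqNgt (leq_ltn_trans sq' sq).
have p0 : p != 0 by apply: contra_not_neq nJp => ->; rewrite lead_coef0.
have s1p : (1 < size p)%N.
  rewrite ltnNge; apply/negP => /size1_polyC e; apply: nJp.
  by rewrite e lead_coefC; apply/IC; rewrite -e.
set l := lead_coef p in nJp.
(* Elements outside [I] of the ideal generated by [h] and [I]; the smallest of
   them, [r], will be a constant. *)
pose inS r := ~ I r /\ exists a b', r = a * h + b' /\ I b'.
have exr : exists k, `[< exists r, inS r /\ size r = k >].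
  exists (size h); apply/asboolP; exists h; split=> //; split=> //.
  exists 1, 0; rewrite mul1r addr0; split=> //.
  by move=> z _; rewrite /uv rmorph0 horner0.
case: (ex_minnP exr) => k /asboolP[r [[nIr [a [b' [er Ib']]]] sr]] kmin.
have rmin q : inS q -> (size r <= size q)%N.
  by move=> qS; rewrite sr; apply: kmin; apply/asboolP; exists q.
have r0 : r != 0.
  by apply: contra_not_neq nIr => -> z _; rewrite /uv rmorph0 horner0.
have srp : (size r < size p)%N.
  suff hS : inS (h %% p) by apply: leq_ltn_trans (rmin _ hS) _; rewrite ltn_modp.
  have /= e := Pdiv.Idomain.divp_eq h p; split.
    move=> Im; have : I (l ^+ scalp h p *: h).
      by rewrite e; apply: Iadd => //; apply: Imul.
    by rewrite -mul_polyC => /IM[/IC/JXn|].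
  exists (l ^+ scalp h p)%:P, (- (h %/ p * p)); split.
    by rewrite mul_polyC e addrC addKr.
  by rewrite -sub0r; apply: Isub; [move=> z _; rewrite /uv rmorph0 horner0|exact: Imul].
have sr1 : (size r <= 1)%N.
  rewrite leqNgt; apply/negP => s1r.
  have /= e := Pdiv.Idomain.divp_eq p r.
  set s := p %/ r in e; set r' := p %% r in e; set lr := _ ^+ _ in e.
  have sr' : (size r' < size r)%N by rewrite ltn_modp.
  have Ir' : I r'.
    apply: contrapT => nI; have : inS r'.
      split=> //; exists (- (s * a)), (lr *: p - s * b'); split.
        by rewrite e er mulrDr mulNr mulrA; ring.
      by apply: Isub; [rewrite -mul_polyC|]; apply: Imul.
    by move=> /rmin; rewrite leqNgt sr'.
  have /IM[Is|//] : I (s * r).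
    rewrite (_ : s * r = lr *: p - r'); last by rewrite e addrK.
    by apply: Isub => //; rewrite -mul_polyC; apply: Imul.
  have ss : (size s < size p)%N.
    have [->|s0] := eqVneq s 0; first by rewrite size_poly0; apply: ltn_trans s1p.
    have : (size (s * r)%R <= size p)%N.
      rewrite (_ : s * r = lr *: p - r'); last by rewrite e addrK.
      apply: leq_trans (size_polyD _ _) _; rewrite size_polyN geq_max.
      by rewrite size_scale_leq ltnW // (ltn_trans sr').
    rewrite size_mul //; move: (size s) (size r) (size p) s1r => x1 x2 x3; lia.
  have Js := Min _ Is ss.
  have Jr' := Min _ Ir' (ltn_trans sr' srp).
  have : J (lr * l).
    have := congr1 (fun q : {poly mpoly m K} => q`_(size p).-1) e.
    rewrite coefZ -lead_coefE -/l => -> z Zz.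
    rewrite coefD rmorphD coefM rmorph_sum big1 => [|i _].
      by rewrite add0r; apply: Jr'.
    by rewrite /= rmorphM [X in X * _]Js ?mul0r.
  case/JM => [/JXn Jl|//].
  have sr0 : (0 < size r)%N by rewrite size_poly_gt0.
  have : inS (r - lead_coef r *: 'X^((size r).-1)).
    have Il : I (lead_coef r *: 'X^((size r).-1)).
      by apply: JcI => i; rewrite coefZ; move=> z Zz; rewrite rmorphM /= Jl ?mul0r.
    split=> [Ir|].
      by apply: nIr; rewrite -(subrK (lead_coef r *: 'X^((size r).-1)) r); apply: Iadd.
    exists a, (b' - lead_coef r *: 'X^((size r).-1)).
    by rewrite addrA -er; split=> //; apply: Isub.
  move=> /rmin; rewrite leqNgt => /negP[].
  rewrite -{2}(prednK sr0) ltnS; apply/leq_sizeP => j; rewrite leq_eqVlt.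
  rewrite coefB coefZ coefXn => /predU1P[<-|].
    by rewrite eqxx mulr1 lead_coefE subrr.
  move=> lj; rewrite gtn_eqF // mulr0 subr0 nth_default //.
  by rewrite -(prednK sr0).
have {}er0 := size1_polyC sr1; set b0 := r`_0 in er0.
exists (l * b0); split.
  by case/JM => // Jb; apply: nIr; rewrite er0; apply/IC.
move=> v vJ; rewrite rmorphM /= mulf_eq0 negb_or => /andP[lv bv].
have /closed_rootP[c rc] : size (map_poly (@ev K v m) p) != 1%N.
  by rewrite size_map_poly_id0 // gtn_eqF.
have Ic q : I q -> uv v c q = 0.
  move=> Iq; have /= e := Pdiv.Idomain.divp_eq q p.
  have Jm : Jc (q %% p).
    apply: Min; last by rewrite ltn_modp.
    rewrite (_ : q %% p = (l ^+ scalp q p)%:P * q - q %/ p * p).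
      by apply: Isub; apply: Imul.
    by rewrite mul_polyC e addrC addKr.
  have /eqP := congr1 (uv v c) e.
  rewrite uvZ uvD uvM (_ : uv v c p = 0); last exact/rootP.
  rewrite mulr0 add0r (uvJ _ vJ Jm) mulf_eq0 rmorphXn expf_eq0 (negbTE lv) andbF.
  by move/eqP.
exists c; split=> //; apply: contraNneq bv => h0.
by rewrite -(uvC v c) -er0 er uvD uvM h0 mulr0 add0r Ic.
Qed.

End Extension.

Section Images.
Context {K : closedFieldType} {T : Type} (y : T -> nat -> K).
Implicit Types (Z A : set T) (n m : nat).

Definition indep n Z := forall P : mpoly n K, vanish y Z P -> P = 0.

Lemma ev_widen n m (P : mpoly n K) : (n <= m)%N ->
  exists Q : mpoly m K, forall v, ev v Q = ev v P.
Proof.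
move=> nm; have [|Q eQ] := @polyfn_comp K m n P (fun i v => v i).
  by move=> i im; apply/polyfnX/(leq_trans im).
by exists Q => v; rewrite -eQ.
Qed.

Lemma prime_on_leq n m Z : (n <= m)%N -> prime_on m y Z -> prime_on n y Z.
Proof.
move=> nm [Z0 pZ]; split=> // P Q; have [P' eP] := ev_widen P nm.
have [Q' eQ] := ev_widen Q nm => PQ.
have [|vP|vQ] := pZ P' Q'.
- by move=> z Zz; rewrite rmorphM /= eP eQ -[LHS]rmorphM; apply: PQ.
- by left=> z Zz; rewrite -eP; apply: vP.
- by right=> z Zz; rewrite -eQ; apply: vQ.
Qed.

(** The previous lemma, iterated to eliminate [k] coordinates. *)
Lemma lift_point n k Z : prime_on (k + n) y Z -> forall h : mpoly (k + n) K,
  ~ vanish y Z h -> exists b : mpoly n K, ~ vanish y Z b /\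
  forall v, (forall P : mpoly n K, vanish y Z P -> ev v P = 0) -> ev v b != 0 ->
  exists w, [/\ forall i, (i < n)%N -> w i = v i,
    forall P : mpoly (k + n) K, vanish y Z P -> ev w P = 0 & ev w h != 0].
Proof.
elim: k => [pZ h nh|k IH pZ h nh].
  by exists h; split=> // v vI vh; exists v.
have [|b1 [nb1 b1P]] := extend_point pZ (h := muni h).
  by apply: contra_not nh => H z Zz; rewrite ev_muni; apply: H.
have [b [nb bP]] := IH (prime_on_leq (leqnSn _) pZ) _ nb1.
exists b; split=> // v vI vb; have [w [wv wI wb1]] := bP v vI vb.
have [c [cI ch]] := b1P w wI wb1.
pose w' i := if i == (k + n)%N then c else w i.
have evw' P : ev w' P = (map_poly (@ev K w (k + n)) (muni P)).[c].
  rewrite ev_muni /w' eqxx; congr (_.[_]); apply: eq_map_poly => Q.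
  by apply: eq_ev => i ik; rewrite ltn_eqF.
exists w'; split.
- move=> i ik; rewrite /w' ltn_eqF ?wv //; exact: leq_trans ik (leq_addl _ _).
- by move=> P vP; rewrite evw'; apply: cI => z Zz; rewrite -ev_muni; apply: vP.
- by rewrite evw'.
Qed.

(** If the first [n] coordinates are independent, no condition but [b != 0] is
    imposed on a point of affine [n]-space for it to lift to [Z]. *)
Lemma image_contains_open n m Z (h : mpoly m K) : (n <= m)%N ->
  prime_on m y Z -> closed_on m y Z -> indep n Z -> ~ vanish y Z h ->
  exists2 b : mpoly n K, b != 0 & forall v, ev v b != 0 ->
    exists z, [/\ Z z, ev (y z) h != 0 & forall i, (i < n)%N -> y z i = v i].
Proof.
move=> /subnK e; move: (m - n)%N e => k e; subst m => pZ cZ iZ nh.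
have [b [nb bP]] := lift_point pZ nh; exists b.
  by apply: contra_not_neq nb => -> z _; rewrite rmorph0.
move=> v vb; have [|w [wv wI wh]] := bP v _ vb.
  by move=> P /iZ->; rewrite rmorph0.
have [z Zz zw] := cZ w wI; exists z; split=> //.
  by rewrite (eq_ev (w := w)).
by move=> i ik; rewrite zw ?wv //; exact: leq_trans ik (leq_addl _ _).
Qed.

(** The image of [Z] in affine [n.+1]-space contains a principal open set, given by
    [b]. For a generic constant [c], the part [h != 0] of the slice [y_n = c] then
    still dominates affine [n]-space, hence so does one of the finitely many
    irreducible sets that make up the slice. *)
Lemma slice n m Z (h : mpoly m K) : (n < m)%N ->
  prime_on m y Z -> closed_on m y Z -> indep n.+1 Z -> ~ vanish y Z h ->
  exists c A, [/\ A `<=` Z, (forall z, A z -> y z n = c), prime_on m y A &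
    [/\ closed_on m y A, indep n A & ~ vanish y A h]].
Proof.
move=> nm pZ cZ iZ nh.
have [b b0 bP] := image_contains_open nm pZ cZ iZ nh.
have [v0 v0b] := ev_neq0 b0; pose c := v0 n.
pose upd (v : nat -> K) i := if i == n then c else v i.
have [bc bcE] : polyfn n (fun v => ev (upd v) b).
  apply: (polyfn_comp b (r := fun i v => upd v i)) => i; rewrite ltnS leq_eqVlt /upd.
  case/predU1P => [->|ik]; first by rewrite eqxx; apply: polyfnC.
  by rewrite ltn_eqF //; apply: polyfnX.
have bc0 : bc != 0.
  apply: contra_neq v0b => e; rewrite (@eq_ev _ v0 (upd v0)) ?bcE ?e ?rmorph0 //.
  by move=> i _; rewrite /upd; case: eqP => // ->.
pose L : mpoly m K := mpolyX K (mnm1 (Ordinal nm)) - mpolyC m c.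
have LE v : ev v L = v n - c by rewrite rmorphB /= evX evC.
have [r [A [Ap Ae]]] := @irreducible_decomposition _ _ m y (cut y Z [set L]).
have AW i : (i < r)%N -> A i `<=` cut y Z [set L].
  by move=> ir z Az; apply/Ae; exists i.
have [[i ir [iA nhA]]|] := pselect (exists2 i, (i < r)%N & indep n (A i) /\ ~ vanish y (A i) h).
  have [pA [S eS]] := Ap i ir.
  exists c, (A i); split=> //; last split=> //.
  - by move=> z /(AW i ir)[].
  - by move=> z /(AW i ir)[_ /(_ L erefl)] /eqP; rewrite LE subr_eq0 => /eqP.
  - by rewrite eS; do 2 apply: closed_on_cut.
(* If no component is suitable, a relation [P i] between the first [n] coordinates
   holds on each component that meets [h != 0], and a point of the slice
   outside all these relations is a contradiction. *)
move=> bad; have /choice[P PP] : forall i, exists P : mpoly n K, P != 0 /\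
    ((i < r)%N -> vanish y (A i) h \/ vanish y (A i) P).
  move=> i; have [ir|] := boolP (i < r)%N; last by exists 1; rewrite oner_eq0.
  have [vh|nv] := pselect (vanish y (A i) h).
    by exists 1; rewrite oner_eq0; split=> // _; left.
  have [iA|] := pselect (indep n (A i)); first by case: bad; exists i.
  by move=> /existsNP[Q /not_implyP[vQ /eqP Q0]]; exists Q; split=> // _; right.
have Q0 : bc * \prod_(i < r) P i != 0.
  by rewrite mulf_neq0 // prodf_seq_neq0; apply/allP => i _; case: (PP i).
have [v] := ev_neq0 Q0; rewrite rmorphM rmorph_prod /= mulf_eq0 negb_or -bcE.
move=> /andP[vb vP]; have [z [Zz zh zv]] := bP _ vb.
have /Ae[i ir Az] : cut y Z [set L] z.
  by split=> // _ ->; rewrite LE zv // /upd eqxx subrr.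
case: (PP i).2 => // [/(_ z Az)|/(_ z Az)] /eqP; first by rewrite (negbTE zh).
rewrite (eq_ev (w := v)) => [|j jn]; last first.
  by rewrite zv; [rewrite /upd ltn_eqF|exact: leqW].
move: vP; rewrite prodf_seq_neq0 => /allP /(_ (Ordinal ir)) /=.
by rewrite mem_index_enum => /(_ isT) /negbTE->.
Qed.

(** The coordinate [y_k] separates [A k], where it is constant, from [A k.+1], where
    it is part of an independent family. *)
Lemma slice_chain n m Z (h : mpoly m K) : (n <= m)%N ->
  prime_on m y Z -> closed_on m y Z -> indep n Z -> ~ vanish y Z h ->
  exists (A : nat -> set T) (c : nat -> K), [/\ A n = Z,
    forall k, (k <= n)%N -> [/\ A k `<=` Z, prime_on m y (A k) & ~ vanish y (A k) h],
    forall k, (k < n)%N -> A k `<=` A k.+1 /\ (forall z, A k z -> y z k = c k) &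
    forall k, (k < n)%N -> exists z, [/\ A k.+1 z, ev (y z) h != 0 & y z k != c k]].
Proof.
elim: n Z => [|n IH] Z nm pZ cZ iZ nh.
  by exists (fun=> Z), (fun=> 0); split=> // k _; split.
have [c [B [BZ Bc pB [cB iB nhB]]]] := slice nm pZ cZ iZ nh.
have [A [d [An Ap Ai Ac]]] := IH B (ltnW nm) pB cB iB nhB.
pose A' k := if k == n.+1 then Z else A k.
pose d' k := if k == n then c else d k.
have AA' k : (k <= n)%N -> A' k = A k by move=> kn; rewrite /A' ltn_eqF.
have dd' k : (k < n)%N -> d' k = d k by move=> kn; rewrite /d' ltn_eqF.
exists A', d'; split.
- by rewrite /A' eqxx.
- move=> k; rewrite leq_eqVlt => /predU1P[->|].
    by rewrite /A' eqxx; split.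
  rewrite ltnS => kn; rewrite AA' //; have [AB pA nA] := Ap k kn.
  by split=> //; apply: subset_trans BZ.
- move=> k; rewrite ltnS => kn; rewrite AA' //; move: kn.
  rewrite leq_eqVlt => /predU1P[->|kn].
    by rewrite An /A' /d' !eqxx.
  by rewrite AA' // dd' //; apply: Ai.
- move=> k; rewrite ltnS leq_eqVlt => /predU1P[->|kn]; last first.
    by rewrite AA' // dd' //; apply: Ac.
  rewrite /A' /d' !eqxx; apply: contrapT => no.
  pose L : mpoly m K := mpolyX K (mnm1 (Ordinal nm)) - mpolyC m c.
  have LE v : ev v L = v n - c by rewrite rmorphB /= evX evC.
  have [|//|vL] := pZ.2 h L.
    move=> z Zz; rewrite rmorphM /= LE; apply/eqP; rewrite mulf_eq0 subr_eq0.
    by apply: contrapT => /negP; rewrite negb_or => /andP[hz zc]; apply: no; exists z.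
  pose L' : mpoly n.+1 K := mpolyX K (mnm1 ord_max) - mpolyC n.+1 c.
  have LE' v : ev v L' = v n - c by rewrite rmorphB /= evX evC.
  have : L' = 0 by apply: iZ => z Zz; rewrite LE' -LE; apply: vL.
  move=> /(congr1 (@ev K (fun=> c + 1) n.+1)) /eqP; rewrite LE' rmorph0 addrAC subrr add0r.
  by rewrite oner_eq0.
Qed.

End Images.

(** * From chains to independent functions *)

Section IndependentChain.
Context {K : closedFieldType} {T : Type} (f : T -> nat -> K).

(** In a nonzero relation between [f_0, ..., f_k] on [Z k.+1], a power of [f_k] can be
    divided out, as [f_k] is not zero on [Z k.+1]. Restricted to [Z k], where
    [f_k] is zero, what is left becomes a nonzero relation between
    [f_0, ..., f_(k-1)]. *)
Lemma indep_of_chain k (Z : nat -> set T) :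
  (forall l, (l <= k)%N -> prime_on k f (Z l)) ->
  (forall l, (l < k)%N -> Z l `<=` Z l.+1) ->
  (forall l, (l < k)%N -> forall z, Z l z -> f z l = 0) ->
  (forall l, (l < k)%N -> exists2 z, Z l.+1 z & f z l != 0) ->
  indep f k (Z k).
Proof.
elim: k => [|k IH] pZ sZ f0 fn0 P vP.
  have [z Zz] := (pZ 0%N (leqnn _)).1; rewrite [P]mpoly0E.
  by rewrite (@eq_ev _ _ (f z)) ?vP ?mpolyC0.
have iZk : indep f k (Z k).
  apply: IH => l lk.
  - by apply: prime_on_leq (leqnSn _) (pZ l (leqW lk)).
  - exact/sZ/leqW.
  - exact/f0/leqW.
  - exact/fn0/leqW.
apply/eqP; rewrite -muni_eq0; apply/negPn/negP => P0.
have [r [q]] := multiplicity_XsubC (muni P) 0; rewrite P0 polyC0 subr0 /= => nq0 eq.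
have [P1 eP1] := muni_surj q.
pose Xk : mpoly k.+1 K := mpolyX K (mnm1 ord_max).
have PE z : ev (f z) P = ev (f z) P1 * f z k ^+ r.
  by rewrite ev_muni eq rmorphM rmorphXn /= map_polyX hornerM horner_exp hornerX -eP1 -ev_muni.
have vXk : ~ vanish f (Z k.+1) (Xk ^+ r).
  move=> H; have [//|z Zz] := fn0 k; apply/negP; rewrite negbK.
  have /eqP := H z Zz; rewrite rmorphXn /= evX expf_eq0 => /andP[_ /eqP/= e].
  by apply/eqP.
have [z Zz|vP1|//] := (pZ k.+1 (leqnn _)).2 P1 (Xk ^+ r).
  by rewrite rmorphM rmorphXn /= evX -PE; apply: vP.
suff q0 : q`_0 = 0 by move/negP: nq0; apply; rewrite /root horner_coef0 q0.
apply: iZk => z Zz; have := vP1 z (sZ k (ltnSn _) z Zz).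
by rewrite ev_muni f0 // eP1 horner_coef0 coef_map.
Qed.

End IndependentChain.

(** * Counting monomials *)

Section LinearDependence.
Context {K : fieldType}.

Lemma linear_dependence (I J : finType) (c : J -> I -> K) : (#|I| < #|J|)%N ->
  exists l : J -> K, (exists j, l j != 0) /\ forall i, \sum_j l j * c j i = 0.
Proof.
move=> IJ; pose A := \matrix_(j < #|J|, i < #|I|) c (enum_val j) (enum_val i).
have /rowV0Pn[v /sub_kermxP vA v0] : kermx A != 0.
  by rewrite -mxrank_eq0 mxrank_ker -lt0n subn_gt0 (leq_ltn_trans _ IJ) // rank_leq_col.
exists (fun j => v 0 (enum_rank j)); split.
  have /rV0Pn[i vi] := v0.
  by exists (enum_val i); rewrite enum_valK.
move=> i; have /rowP /(_ (enum_rank i)) := vA; rewrite !mxE => e.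
rewrite -[RHS]e (reindex_onto enum_val enum_rank) /= => [|j _]; last exact: enum_rankK.
by apply: eq_big => [j|j _]; rewrite enum_valK ?eqxx // mxE enum_rankK.
Qed.

End LinearDependence.

Section Degree.
Context {K : closedFieldType} {s : nat}.
Implicit Types (P Q : mpoly s K) (J : {set 'I_s}).

Definition degle k P := forall m, m \in msupp P -> (mdeg m <= k)%N.

Lemma degle_leq k l P : (k <= l)%N -> degle k P -> degle l P.
Proof. by move=> kl dP m /dP /leq_trans; apply. Qed.

Lemma degle_ex P : exists k, degle k P.
Proof.
exists (\max_(m <- msupp P) mdeg m)%N => m mP.
by rewrite (bigD1_seq m) ?msupp_uniq //= leq_maxl.
Qed.

Lemma degle0 k : degle k 0.
Proof. by move=> m; rewrite -mpolyC0 msupp0. Qed.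

Lemma degleC k c : degle k (mpolyC s c).
Proof. by move=> m; rewrite msuppC; case: ifP => // _; rewrite inE => /eqP->; rewrite mdeg0. Qed.

Lemma degleXm m : degle (mdeg m) (mpolyX K m).
Proof. by move=> m'; rewrite msuppX inE => /eqP->. Qed.

Lemma degleB k P Q : degle k P -> degle k Q -> degle k (P - Q).
Proof. by move=> dP dQ m /msuppB_le; rewrite mem_cat => /orP[/dP|/dQ]. Qed.

Lemma degleM k l P Q : degle k P -> degle l Q -> degle (k + l) (P * Q).
Proof.
move=> dP dQ m /msuppM_le /allpairsP[[m1 m2] [/= /dP d1 /dQ d2 ->]].
by rewrite mdegD leq_add.
Qed.

Lemma degleXn k P e : degle k P -> degle (e * k) (P ^+ e).
Proof.
move=> dP; elim: e => [|e IH]; first by rewrite expr0 -mpolyC1; apply: degleC.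
by rewrite exprS mulSn; apply: degleM.
Qed.

Lemma degle_prod k r (F : 'I_r -> mpoly s K) :
  (forall i, degle k (F i)) -> degle (r * k) (\prod_(i < r) F i).
Proof.
elim: r F => [|r IH] F dF; first by rewrite big_ord0 -mpolyC1; apply: degleC.
by rewrite big_ord_recl mulSn; apply: degleM => //; apply: IH.
Qed.

(** Only the variables in [J] matter; stated through values rather than monomials,
    this is immediate for polynomials obtained from [polyfn]. *)
Definition depends (J : {set 'I_s}) P := forall v w : nat -> K,
  (forall i, i \in J -> v i = w i) -> ev v P = ev w P.

Lemma depends_sub J (J' : {set 'I_s}) P : J \subset J' -> depends J P -> depends J' P.
Proof. by move=> sJ dP v w e; apply: dP => i /(fintype.subsetP sJ)/e. Qed.

Lemma dependsC J c : depends J (mpolyC s c).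
Proof. by move=> v w _; rewrite !evC. Qed.

Lemma dependsX J i : i \in J -> depends J (mpolyX K (mnm1 i)).
Proof. by move=> iJ v w e; rewrite !evX e. Qed.

Lemma dependsB J P Q : depends J P -> depends J Q -> depends J (P - Q).
Proof. by move=> dP dQ v w e; rewrite !rmorphB /= (dP v w e) (dQ v w e). Qed.

Lemma dependsM J P Q : depends J P -> depends J Q -> depends J (P * Q).
Proof. by move=> dP dQ v w e; rewrite !rmorphM /= (dP v w e) (dQ v w e). Qed.

Lemma dependsXn J P e : depends J P -> depends J (P ^+ e).
Proof. by move=> dP v w ee; rewrite !rmorphXn /= (dP v w ee). Qed.

Definition supported (J : {set 'I_s}) (m : multinom s) := [forall i, (i \in J) || (m i == 0%N)].

Lemma dependsXm J m : supported J m -> depends J (mpolyX K m).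
Proof.
move=> /forallP mJ v w e; rewrite !evXm; apply: eq_bigr => i _.
by case/orP: (mJ i) => [/e->//|/eqP->]; rewrite !expr0.
Qed.

(** Setting the variables outside [J] to zero does not change the value. *)
Lemma depends_ev J P v : depends J P ->
  ev v P = \sum_(m <- msupp P | supported J m) mcoeff m P * ev v (mpolyX K m).
Proof.
move=> dP; pose w (i : nat) := if [exists j in J, val j == i] then v i else 0.
have wJ i : w (val i) = if i \in J then v i else 0.
  rewrite /w; congr (if _ then _ else _); apply/idP/idP => [/existsP[j]|iJ].
    by move=> /andP[jJ /eqP/val_inj <-].
  by apply/existsP; exists i; rewrite iJ eqxx.
rewrite (dP v w) => [|i iJ]; last by rewrite wJ iJ.
rewrite evE [RHS]big_mkcond; apply: eq_bigr => m _ /=.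
case: ifPn => [/forallP mJ|/forallPn[i]].
  rewrite evXm; congr (_ * _); apply: eq_bigr => i _; rewrite wJ.
  by case/orP: (mJ i) => [->//|/eqP->]; rewrite !expr0.
rewrite negb_or => /andP[iJ mi]; rewrite (bigD1 i) //= wJ (negbTE iJ).
by rewrite expr0n (negbTE mi) mul0r mulr0.
Qed.

End Degree.

Section Growth.
Context {K : closedFieldType} {T : Type} (s : nat) (y : T -> nat -> K) (Z : set T).
Hypothesis pZ : prime_on s y Z.
Implicit Types (P Q : mpoly s K) (J A : {set 'I_s}).

Definition in_span (I : finType) (w : I -> T -> K) (g : T -> K) :=
  exists c : I -> K, forall z, Z z -> g z = \sum_i c i * w i z.

Lemma in_span_sum (I : finType) (w : I -> T -> K) (L : Type) (r : seq L)
    (p : pred L) (a : L -> K) (g : L -> T -> K) :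
  (forall l, p l -> in_span w (g l)) ->
  in_span w (fun z => \sum_(l <- r | p l) a l * g l z).
Proof.
move=> gw; have /choice[c cP] : forall l, exists c : I -> K, p l ->
    forall z, Z z -> g l z = \sum_i c i * w i z.
  by move=> l; case: (boolP (p l)) => [/gw[c cP]|_]; [exists c|exists (fun=> 0)].
exists (fun i => \sum_(l <- r | p l) a l * c l i) => z Zz.
under [RHS]eq_bigr do rewrite mulr_suml.
rewrite exchange_big; apply: eq_bigr => l pl.
rewrite cP // mulr_sumr; apply: eq_bigr => i _; exact: mulrA.
Qed.

Lemma in_span_eq (I : finType) (w : I -> T -> K) g g' :
  (forall z, Z z -> g z = g' z) -> in_span w g' -> in_span w g.
Proof. by move=> e [c cP]; exists c => z Zz; rewrite e // cP. Qed.

(** Up to multiplication by a fixed [P] to the power of the degree, the polynomials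
    in the variables [J] grow on [Z] at most like those in [d] variables. *)
Definition growth d J := exists P C, ~ vanish y Z P /\
  forall M, exists (I : finType) (w : I -> T -> K), (#|I| <= C * M.+1 ^ d)%N /\
  forall m : multinom s, supported J m -> (mdeg m <= M)%N ->
    in_span w (fun z => ev (y z) P ^+ M * ev (y z) (mpolyX K m)).

Lemma vanish_exp P k : vanish y Z (P ^+ k) -> vanish y Z P.
Proof.
move=> vP; have [//|nP] := pselect (vanish y Z P).
elim: k vP => [|k IH]; last by rewrite exprS => /pZ.2[].
have [z Zz] := pZ.1; move=> /(_ z Zz) /eqP.
by rewrite expr0 rmorph1 oner_eq0.
Qed.

Lemma growth_poly d J : growth d J -> exists P C, ~ vanish y Z P /\
  forall M, exists (I : finType) (w : I -> T -> K), (#|I| <= C * M.+1 ^ d)%N /\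
  forall Q, depends J Q -> degle M Q ->
    in_span w (fun z => ev (y z) P ^+ M * ev (y z) Q).
Proof.
move=> [P [C [nP PC]]]; exists P, C; split=> // M.
have [I [w [cI Iw]]] := PC M; exists I, w; split=> // Q dQ degQ.
apply: (@in_span_eq _ _ _ (fun z => \sum_(m <- msupp Q | (m \in msupp Q) && supported J m)
    mcoeff m Q * (ev (y z) P ^+ M * ev (y z) (mpolyX K m)))).
  move=> z _; rewrite (depends_ev _ dQ) mulr_sumr [LHS]big_seq_cond.
  by apply: eq_bigr => m _; rewrite mulrCA.
by apply: in_span_sum => m /andP[mQ mJ]; apply: Iw => //; apply: degQ.
Qed.

Lemma growth_variables A : growth #|A| A.
Proof.
exists 1, 1%N; split.
  by have [z Zz] := pZ.1; move=> /(_ z Zz) /eqP; rewrite rmorph1 oner_eq0.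
move=> M; exists {ffun 'I_#|A| -> 'I_M.+1}.
pose av (j : 'I_#|A|) : 'I_s := enum_val j.
exists (fun (g : {ffun 'I_#|A| -> 'I_M.+1}) z => \prod_j y z (av j) ^+ g j); split.
  by rewrite card_ffun !card_ord mul1n.
move=> m mA dm; pose g0 : {ffun 'I_#|A| -> 'I_M.+1} := [ffun j => inord (m (av j))].
exists (fun g => (g == g0)%:R) => z _; rewrite (bigD1 g0) //= eqxx mul1r.
rewrite [X in _ + X]big1 ?addr0 => [|g /negbTE->]; last by rewrite mul0r.
rewrite rmorph1 expr1n mul1r evXm (bigID (fun i => i \in A)) /= mulrC big1 => [|i iA].
  rewrite mul1r big_enum_val; apply: eq_bigr => j _; rewrite ffunE inordK // ltnS.
  by apply: leq_trans dm; rewrite mdegE (bigD1 (av j)) //= leq_addr.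
by have /forallP/(_ i) := mA; rewrite (negbTE iA) => /eqP->; rewrite expr0.
Qed.

(** The leading coefficient has to be nonzero on [Z], not just as a polynomial. *)
Definition algebraic_over J (t : T -> K) := exists p : {poly mpoly s K},
  [/\ forall l, depends J p`_l, ~ vanish y Z (lead_coef p) &
      forall z, Z z -> (map_poly (@ev K (y z) s) p).[t z] = 0].

(** If [Q] is the leading coefficient of a relation of degree [e] for [t], then
    [Q * t ^ e] is a combination of lower powers of [t]. So one factor [Q] per power
    of [t] is enough to stay below [e], and degrees grow linearly. *)
Lemma power_reduction J t : algebraic_over J t -> exists e D Q, ~ vanish y Z Q /\
  [/\ depends J Q, degle D Q &
  forall k, exists r : nat -> mpoly s K,
    (forall l, depends J (r l) /\ degle (k * D) (r l)) /\
    forall z, Z z -> ev (y z) Q ^+ k * t z ^+ k = \sum_(l < e) ev (y z) (r l) * t z ^+ l].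
Proof.
move=> [p [pJ nl pt]]; have p0 : p != 0.
  by apply: contra_not_neq nl => -> z _; rewrite lead_coef0 rmorph0.
have [e sp] : exists e, size p = e.+2.
  case sp: (size p) => [|[|e]]; last by exists e.
    by move/eqP: sp; rewrite size_poly_eq0 (negbTE p0).
  case: nl => z Zz; have := pt z Zz; have /size1_polyC -> : (size p <= 1)%N by rewrite sp.
  by rewrite lead_coefC map_polyC hornerC.
have /choice[D0 D0P] := fun l => degle_ex p`_l.
pose D := (\max_(l < e.+2) D0 l)%N.
have DP l : degle D p`_l.
  have [le|ge] := ltnP l e.+2; last by rewrite nth_default ?sp //; apply: degle0.
  by apply: degle_leq (D0P l); rewrite /D (bigD1 (Ordinal le)) //= leq_maxl.
set b := lead_coef p in nl.
have bE : b = p`_e.+1 by rewrite /b lead_coefE sp.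
exists e.+1, D, b; split=> //; split; rewrite ?bE //.
elim=> [|k [r [rP rE]]].
  exists (fun l => if l == 0%N then 1 else 0); split.
    move=> [|l] /=; split.
    - by rewrite -mpolyC1; apply: dependsC.
    - by rewrite -mpolyC1; apply: degleC.
    - by rewrite -mpolyC0; apply: dependsC.
    - exact: degle0.
  move=> z Zz; rewrite big_ord_recl /= !expr0 rmorph1 mulr1 big1 ?addr0 // => i _.
  by rewrite rmorph0 mul0r.
(* Multiply by [b * t] and replace [b * t ^ e.+1] by the lower terms. *)
exists (fun l => (if l is l'.+1 then b * r l' else 0) - r e * p`_l); split.
  move=> l; split.
    apply: dependsB; last by apply: dependsM => //; case: (rP e).
    case: l => [|l]; first by rewrite -mpolyC0; apply: dependsC.
    by apply: dependsM; rewrite ?bE //; case: (rP l).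
  rewrite mulSn; apply: degleB; last by rewrite addnC; apply: degleM => //; case: (rP e).
  case: l => [|l]; first exact: degle0.
  by apply: degleM; rewrite ?bE //; case: (rP l).
move=> z Zz; rewrite -bE !exprS mulrACA bE rE // -bE.
have := pt z Zz; rewrite horner_map_ev sp big_ord_recr /= -bE => /eqP.
rewrite addr_eq0 => /eqP pe.
under [RHS]eq_bigr do rewrite rmorphB /= mulrBl.
rewrite sumrB [X in _ = X - _]big_ord_recl /= rmorph0 mul0r add0r.
under [X in _ = _ - X]eq_bigr do rewrite rmorphM /= -mulrA.
rewrite -mulr_sumr pe mulrN opprK.
rewrite big_ord_recr /= mulrDr mulr_sumr; congr (_ + _).
  by apply: eq_bigr => i _; rewrite /bump /= add1n rmorphM /= exprS; ring.
by rewrite exprS; ring.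
Qed.

Lemma leq_expl a b d : (a <= b)%N -> (a ^ d <= b ^ d)%N.
Proof. by move=> ab; elim: d => // d IH; rewrite !expnS leq_mul. Qed.

(** A new variable that is algebraic over [J] multiplies the number of functions by
    the degree [e] of its relation, and the degrees by a constant. *)
Lemma growth_algebraic d J (i : 'I_s) : growth d J -> algebraic_over J (fun z => y z i) ->
  growth d (i |: J).
Proof.
move=> /growth_poly[P [C [nP PC]]] /power_reduction[e [D [b [nb [bJ degb red]]]]].
exists (b * P ^+ D.+1), (e * (C * D.+1 ^ d))%N; split.
  by case/pZ.2 => // /vanish_exp.
move=> M; have [I [w [cI Iw]]] := PC (M * D.+1)%N.
exists ('I_e * I)%type, (fun (li : 'I_e * I) z => y z i ^+ li.1 * w li.2 z); split.
  rewrite card_prod card_ord -!mulnA leq_mul2l; apply/orP; right.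
  apply: leq_trans cI _; rewrite leq_mul2l -expnMn leq_expl ?orbT //; lia.
move=> m mJ dm; pose k := m i.
pose m' : multinom s := Multinom [tuple if j == i then 0%N else m j | j < s].
have m'E j : m' j = if j == i then 0%N else m j by rewrite mnmE.
have mE z : ev (y z) (mpolyX K m) = ev (y z) (mpolyX K m') * y z i ^+ k.
  rewrite !evXm (bigD1 i) //= mulrC; congr (_ * _).
  rewrite [RHS](bigD1 i) //= m'E eqxx expr0 mul1r.
  by apply: eq_bigr => j /negbTE ji; rewrite m'E ji.
have degm : (mdeg m = mdeg m' + k)%N.
  rewrite !mdegE (bigD1 i) //= addnC; congr (_ + _)%N.
  rewrite [RHS](bigD1 i) //= m'E eqxx add0n.
  by apply: eq_bigr => j /negbTE ji; rewrite m'E ji.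
have m'J : supported J m'.
  apply/forallP => j; rewrite m'E; case: (eqVneq j i) => [_|ji]; first by rewrite orbT.
  by have /forallP/(_ j) := mJ; rewrite !inE (negbTE ji).
have kM : (k <= M)%N by apply: leq_trans dm; rewrite degm leq_addl.
have [r [rP rE]] := red k.
have /choice[c cP] : forall l, exists c : I -> K, forall z, Z z ->
    ev (y z) P ^+ (M * D.+1) * ev (y z) (b ^+ (M - k) * mpolyX K m' * r l) =
    \sum_i c i * w i z.
  move=> l; have [rJ rd] := rP l; apply: Iw.
    by apply: dependsM => //; apply: dependsM; [apply: dependsXn|apply: dependsXm].
  apply: (@degle_leq _ _ ((M - k) * D + mdeg m' + k * D)%N).
    rewrite mulnS addnAC -mulnDl subnK // addnC leq_add2r.
    by apply: leq_trans dm; rewrite degm leq_addr.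
  by apply: degleM => //; apply: degleM; [apply: degleXn|apply: degleXm].
exists (fun li : 'I_e * I => c li.1 li.2) => z Zz.
rewrite -(pair_bigA _ (fun (l : 'I_e) i0 => c l i0 * (y z i ^+ l * w i0 z))) /=.
under eq_bigr => l _.
  under eq_bigr do rewrite mulrCA.
  rewrite -mulr_sumr -cP // !rmorphM rmorphXn /= !mulrA.
  over.
rewrite mE rmorphM rmorphXn /= exprMn -exprM [(D.+1 * M)%N]mulnC.
transitivity (ev (y z) P ^+ (M * D.+1) * ev (y z) b ^+ (M - k) *
   ev (y z) (mpolyX K m') * (ev (y z) b ^+ k * y z i ^+ k)).
  by rewrite -{1}(subnK kM) exprD; ring.
by rewrite rE // mulr_sumr; apply: eq_bigr => l _; ring.
Qed.

(** There are [L.+1 ^ r] products of the [f i] with exponents at most [L]. After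
    multiplication by a power of [P], they lie in a space whose dimension is of
    the order of [L ^ d]. If [d < r], they are linearly dependent for large [L],
    which is an algebraic relation between the [f i]. *)
Lemma growth_bound d J r (f : nat -> mpoly s K) :
  growth d J -> (forall i, (i < r)%N -> depends J (f i)) ->
  indep (fun z i => ev (y z) (f i)) r Z -> (r <= d)%N.
Proof.
move=> /growth_poly[P [C [nP PC]]] fJ ind; rewrite leqNgt; apply/negP => dr.
have /choice[D0 D0P] := fun l => degle_ex (f l).
pose D := (\max_(l < r) D0 l)%N.
have DP l : (l < r)%N -> degle D (f l).
  by move=> le; apply: degle_leq (D0P l); rewrite /D (bigD1 (Ordinal le)) //= leq_maxl.
(* Chosen so that [L.+1 ^ r] exceeds the dimension available in degree [r * L * D]. *)
pose L := (C * (r * D).+1 ^ d)%N.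
have [I [w [cI Iw]]] := PC (r * (L * D))%N.
have card : (#|I| < #|{ffun 'I_r -> 'I_L.+1}|)%N.
  rewrite card_ffun !card_ord; apply: leq_ltn_trans cI _.
  apply: (@leq_trans (L.+1 * L.+1 ^ d)%N); last by rewrite -expnS leq_pexp2l.
  apply: (@leq_ltn_trans (L * L.+1 ^ d)%N); last by rewrite ltn_mul2r expn_gt0 /=.
  have -> : (L * L.+1 ^ d = C * ((r * D).+1 * L.+1) ^ d)%N by rewrite {1}/L expnMn mulnA.
  rewrite leq_mul2l leq_expl ?orbT //.
  by move: (L) => l; nia.
pose F (g : {ffun 'I_r -> 'I_L.+1}) := \prod_(i < r) f i ^+ g i.
have /choice[c cP] : forall g : {ffun 'I_r -> 'I_L.+1}, exists c : I -> K,
    forall z, Z z -> ev (y z) P ^+ (r * (L * D)) * ev (y z) (F g) = \sum_i c i * w i z.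
  move=> g; apply: Iw.
    move=> v u vu; rewrite !rmorph_prod; apply: eq_bigr => i _ /=.
    by rewrite !rmorphXn /= (fJ i (ltn_ord i) v u vu).
  apply: degle_prod => i; have := degleXn (e := g i) (DP i (ltn_ord i)).
  by apply: degle_leq; rewrite leq_mul2r -ltnS ltn_ord orbT.
have [l [[g0 lg0] lc]] := linear_dependence c card.
pose mg (g : {ffun 'I_r -> 'I_L.+1}) : multinom r := Multinom [tuple (g i : nat) | i < r].
pose Q : mpoly r K := \sum_g l g *: mpolyX K (mg g).
have Q0 : Q != 0.
  apply: contraNneq lg0 => /(congr1 (mcoeff (mg g0))).
  rewrite mcoeff0 raddf_sum (bigD1 g0) //= big1 ?addr0 => [|g gg0].
    by rewrite mcoeffZ mcoeffX eqxx mulr1 => ->.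
  rewrite mcoeffZ mcoeffX; case: eqP => [e|]; last by rewrite mulr0.
  case/eqP: gg0; apply/ffunP => i; apply: val_inj.
  by have := congr1 (fun mm : multinom r => mm i) e; rewrite !mnmE.
pose QF := \sum_g l g *: F g.
have QFE z : ev (fun i => ev (y z) (f i)) Q = ev (y z) QF.
  rewrite !rmorph_sum; apply: eq_bigr => g _; rewrite /= !evZ evXm rmorph_prod.
  by congr (_ * _); apply: eq_bigr => i _; rewrite rmorphXn /= mnmE.
have [z Zz|/vanish_exp//|vQ] := pZ.2 (P ^+ (r * (L * D))) QF.
  rewrite rmorphM rmorphXn rmorph_sum /= mulr_sumr.
  under eq_bigr do rewrite evZ mulrCA cP // mulr_sumr.
  rewrite exchange_big big1 // => i _ /=.
  under eq_bigr do rewrite mulrA.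
  by rewrite -mulr_suml lc mul0r.
by case/eqP: Q0; apply: ind => z Zz; rewrite QFE; apply: vQ.
Qed.

End Growth.

(** * Independent sets of coordinates *)

Section IndependentVariables.
Context {K : closedFieldType} {T : Type} (s : nat) (y : T -> nat -> K) (Z : set T).
Implicit Types (P Q : mpoly s K) (J A B : {set 'I_s}).

Definition indep_vars A := forall P, depends A P -> vanish y Z P -> P = 0.

Lemma indep_vars_sub A B : A \subset B -> indep_vars B -> indep_vars A.
Proof. by move=> AB iB P dP; apply: iB; apply: depends_sub dP. Qed.

Lemma algebraic_over_sub A B t : A \subset B ->
  algebraic_over y Z A t -> algebraic_over y Z B t.
Proof.
move=> AB [p [pA nl pt]]; exists p; split=> // l.
exact: depends_sub (pA l).
Qed.

Lemma mpoly_ext n (P Q : mpoly n K) : (forall v, ev v P = ev v Q) -> P = Q.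
Proof.
move=> e; apply/eqP; rewrite -subr_eq0; apply: contraT => /ev_neq0[v].
by rewrite rmorphB /= e subrr eqxx.
Qed.

Lemma upoly_ext (p q : {poly K}) : (forall c, p.[c] = q.[c]) -> p = q.
Proof.
move=> e; apply/eqP; rewrite -subr_eq0; apply: contraT => /closed_nonrootP[c].
by rewrite /root !hornerE e subrr eqxx.
Qed.

(** Any variable can be singled out, not only the last one. *)
Lemma mpoly_in_variable (i : 'I_s) P : exists p : {poly mpoly s K}, forall v c,
  (map_poly (@ev K v s) p).[c] = ev (fun j => if j == i then c else v j) P.
Proof.
pose rest (m : multinom s) : multinom s := Multinom [tuple if j == i then 0%N else m j | j < s].
exists (\sum_(m <- msupp P) (mcoeff m P *: mpolyX K (rest m)) *: 'X^(m i)) => v c.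
rewrite rmorph_sum horner_sum evE; apply: eq_bigr => m _ /=.
rewrite -mul_polyC rmorphM /= map_polyC /= map_polyXn hornerM hornerXn hornerC evZ evXm -mulrA.
rewrite (bigD1 i) //= [in RHS](bigD1 i) //= mnmE eqxx expr0 mul1r mulrC eqxx [c ^+ _ * _]mulrC.
rewrite mulrC; congr (_ * (_ * _)); apply: eq_bigr => j ji.
by rewrite mnmE (negbTE ji) val_eqE (negbTE ji).
Qed.

Hypothesis pZ : prime_on s y Z.

Lemma algebraic_over_mem A (i : 'I_s) : i \in A -> algebraic_over y Z A (fun z => y z i).
Proof.
move=> iA; exists ('X - (mpolyX K (mnm1 i))%:P); split.
- move=> l; rewrite coefB coefX coefC; apply: dependsB.
    by rewrite -[_%:R]/(_%:R) -mpolyC_nat; apply: dependsC.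
  by case: ifP => _; [apply: dependsX|rewrite -mpolyC0; apply: dependsC].
- have [z Zz] := pZ.1; move=> /(_ z Zz) /eqP.
  by rewrite lead_coefXsubC rmorph1 oner_eq0.
- by move=> z _; rewrite rmorphB /= map_polyX map_polyC /= evX !hornerE subrr.
Qed.

(** Written as a polynomial in the variable [i], a relation has a leading coefficient
    that depends on [A] only, hence is not zero on [Z] by independence of [A]. *)
Lemma dependent_algebraic A (i : 'I_s) : indep_vars A -> ~ indep_vars (i |: A) ->
  algebraic_over y Z A (fun z => y z i).
Proof.
move=> iA /existsNP[P /not_implyP[dP /not_implyP[vP /eqP P0]]].
have [p pE] := mpoly_in_variable i P.
have pA l : depends A p`_l.
  move=> v w vw; rewrite -!coef_map /=.
  suff -> : map_poly (@ev K v s) p = map_poly (@ev K w s) p by [].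
  apply: upoly_ext => c; rewrite !pE; apply: dP => j; rewrite !inE.
  by case/predU1P => [->|/vw ->//]; rewrite eqxx.
have pv v : (map_poly (@ev K v s) p).[v i] = ev v P.
  by rewrite pE; apply: eq_ev => j _; case: eqP => // ->.
have p0 : p != 0.
  by apply: contra_neq P0 => p0; apply: mpoly_ext => v; rewrite -pv p0 !rmorph0 horner0.
exists p; split=> //; last by move=> z Zz; rewrite pv vP.
move=> vl; case/eqP: p0; apply/eqP; rewrite -lead_coef_eq0; apply/eqP.
by apply: iA => //; rewrite lead_coefE.
Qed.

Lemma indep_vars0 : indep_vars finset.set0.
Proof.
move=> P dP vP; apply: mpoly_ext => v; have [z Zz] := pZ.1.
by rewrite rmorph0 -(vP z Zz); apply: dP => i; rewrite inE.
Qed.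

(** By maximality, adding any [i] of [J] to [B] creates a relation, and this relation
    involves [i] effectively. *)
Lemma maximal_indep A J : indep_vars A -> A \subset J -> exists B,
  [/\ A \subset B, B \subset J, indep_vars B &
      forall i, i \in J -> algebraic_over y Z B (fun z => y z i)].
Proof.
move=> iA AJ; pose pr B := (B \subset J) && `[< indep_vars B >].
have [|B maxB AB] := @maxset_exists _ pr A.
  by rewrite /pr AJ; apply/asboolP.
have /maxsetP[/andP[BJ /asboolP iB] Bmax] := maxB.
exists B; split=> // i iJ; have [iB'|iB'] := boolP (i \in B).
  exact: algebraic_over_mem.
apply: dependent_algebraic => // iiB.
have e : i |: B = B.
  apply: Bmax; last exact: finset.subsetU1.
  by rewrite /pr finset.subUset finset.sub1set iJ BJ; apply/asboolP.
by move: iB'; rewrite -e finset.setU11.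
Qed.

Lemma growth_union d J J' : growth y Z d J ->
  (forall i, i \in J' -> algebraic_over y Z J (fun z => y z i)) ->
  growth y Z d (J' :|: J).
Proof.
move=> gJ; have [n] := ubnP #|J'|; elim: n J' => // n IH J' J'n aJ.
have [->|[i iJ]] := finset.set_0Vmem J'; first by rewrite finset.set0U.
rewrite -(finset.setD1K iJ) -finset.setUA; apply: growth_algebraic => //.
  apply: IH => [|j]; first by rewrite [#|_|](cardsD1 i) iJ in J'n.
  by rewrite !inE => /andP[_ /aJ].
apply: algebraic_over_sub (aJ i iJ); exact: finset.subsetUr.
Qed.

Definition var_nth A k := nth 0%N [seq val i | i <- enum A] k.

Lemma var_nthP A k : (k < #|A|)%N -> exists2 i : 'I_s, i \in A & var_nth A k = i.
Proof.
move=> kA; have ka : (k < size (enum A))%N by rewrite -cardE.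
have [i0 _] : exists i0, i0 \in A by apply/card_gt0P; apply: leq_ltn_trans kA.
exists (nth i0 (enum A) k); last by rewrite /var_nth (nth_map i0).
by rewrite -mem_enum mem_nth.
Qed.

Lemma indep_var_nth A : indep_vars A -> indep (fun z k => y z (var_nth A k)) #|A| Z.
Proof.
move=> iA P vP; have [Q QE] : polyfn s (fun v => ev (fun k => v (var_nth A k)) P).
  apply: (polyfn_comp P (r := fun k v => v (var_nth A k))) => k kA.
  by have [i _ ->] := var_nthP kA; apply: polyfnX.
have Q0 : Q = 0.
  apply: iA => [v w vw|z Zz]; last by rewrite -QE; apply: vP.
  by rewrite -!QE; apply: eq_ev => k kA; have [i iA ->] := var_nthP kA; apply: vw.
apply: mpoly_ext => u; rewrite rmorph0.
transitivity (ev (fun i => u (index i [seq val i | i <- enum A])) Q); last by rewrite Q0 rmorph0.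
rewrite -QE; apply: eq_ev => k kA; rewrite /var_nth index_uniq //.
  by rewrite size_map -cardE.
by rewrite map_inj_uniq ?enum_uniq //; apply: val_inj.
Qed.

Lemma growth_card d J A : growth y Z d J -> A \subset J -> indep_vars A -> (#|A| <= d)%N.
Proof.
move=> gJ AJ /indep_var_nth iA.
have /choice[f fP] : forall k, exists P : mpoly s K, (k < #|A|)%N ->
    depends J P /\ forall v, ev v P = v (var_nth A k).
  move=> k; case: (ltnP k #|A|) => [kA|]; last by exists 0.
  have [i iA' e] := var_nthP kA; exists (mpolyX K (mnm1 i)) => _; split.
    by apply: dependsX; apply: (fintype.subsetP AJ).
  by move=> v; rewrite e evX.
apply: (growth_bound (f := f) pZ gJ) => [i /fP[]//|].
move=> P vP; apply: iA => z Zz; rewrite -(vP z Zz).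
by apply: eq_ev => k kA; have [_ ->] := fP k kA.
Qed.

End IndependentVariables.

(** * Rational coordinates and products *)

Section RationalCoordinates.
Context {K : closedFieldType} {T : Type} (n s : nat) (u y : T -> nat -> K).
Implicit Types (Z : set T).

Lemma clear_denominators Z (q : mpoly n K) :
  (forall i, (i < s)%N -> exists p : mpoly n K,
    forall z, Z z -> y z i * ev (u z) q = ev (u z) p) ->
  forall P : mpoly s K, exists M (R : mpoly n K),
    forall z, Z z -> ev (y z) P * ev (u z) q ^+ M = ev (u z) R.
Proof.
move=> yq P; have /choice[p pE] : forall i : 'I_s, exists p : mpoly n K,
    forall z, Z z -> y z i * ev (u z) q = ev (u z) p by move=> i; apply: yq.
have [M MP] := degle_ex P; exists M.
exists (\sum_(m <- msupp P) mcoeff m P *: (\prod_i p i ^+ m i * q ^+ (M - mdeg m))).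
move=> z Zz; rewrite evE rmorph_sum mulr_suml [LHS]big_seq [RHS]big_seq.
apply: eq_bigr => m mP /=; rewrite evZ rmorphM rmorph_prod rmorphXn /= -mulrA.
congr (_ * _); rewrite -{1}(subnKC (MP m mP)) exprD mulrA; congr (_ * _).
rewrite mdegE -prodrXr -big_split; apply: eq_bigr => i _ /=.
by rewrite rmorphXn /= -pE // exprMn.
Qed.

(** By [clear_denominators], polynomials in the new coordinates are polynomials in
    the old ones up to a factor without zeros. *)
Lemma prime_on_rational Z (q : mpoly n K) :
  prime_on n u Z -> (forall z, Z z -> ev (u z) q != 0) ->
  (forall i, (i < s)%N -> exists p : mpoly n K,
    forall z, Z z -> y z i * ev (u z) q = ev (u z) p) ->
  prime_on s y Z.
Proof.
move=> [Z0 pZ] qZ yq; split=> // P Q PQ.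
have [M [P' PE]] := clear_denominators yq P.
have [N [Q' QE]] := clear_denominators yq Q.
have [z Zz|vP|vQ] := pZ P' Q'.
- rewrite rmorphM /= -PE // -QE // mulrACA -rmorphM /= PQ ?mul0r //.
- left=> z Zz; have /eqP := vP z Zz; rewrite -PE // mulf_eq0 expf_eq0.
  by rewrite (negbTE (qZ z Zz)) andbF orbF => /eqP.
- right=> z Zz; have /eqP := vQ z Zz; rewrite -QE // mulf_eq0 expf_eq0.
  by rewrite (negbTE (qZ z Zz)) andbF orbF => /eqP.
Qed.

Lemma prime_on_open Z (h : mpoly n K) : prime_on n u Z -> ~ vanish u Z h ->
  prime_on n u [set z | Z z /\ ev (u z) h != 0].
Proof.
move=> [Z0 pZ] nh; split.
  apply: contrapT => no; apply: nh => z Zz; apply/eqP; apply: contrapT => /negP hz.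
  by apply: no; exists z.
move=> P Q PQ; have ZD R : vanish u Z (R * h) -> vanish u Z R \/ vanish u Z h by apply: pZ.
have [z Zz|vP|/ZD[vQ|//]] := pZ P (Q * h).
- have [hz|hz] := eqVneq (ev (u z) h) 0; first by rewrite !rmorphM /= hz !mulr0.
  by rewrite mulrA rmorphM /= PQ ?mul0r.
- by left=> z [Zz _]; apply: vP.
- by right=> z [Zz _]; apply: vQ.
Qed.

End RationalCoordinates.

Section ProductCoordinates.
Context {K : closedFieldType} {T1 T2 : Type}.
Variables (n1 n2 : nat) (u1 : T1 -> nat -> K) (u2 : T2 -> nat -> K).

Definition prod_coord (z : T1 * T2) i := if (i < n1)%N then u1 z.1 i else u2 z.2 (i - n1).

Lemma prod_coord1 (P : mpoly (n1 + n2) K) z2 : exists Q : mpoly n1 K,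
  forall z1, ev (u1 z1) Q = ev (prod_coord (z1, z2)) P.
Proof.
have [|Q QE] := @polyfn_comp K n1 (n1 + n2) P
    (fun i v => if (i < n1)%N then v i else u2 z2 (i - n1)).
  by move=> i _; have [lt|_] := ltnP i n1; [exact: polyfnX|exact: polyfnC].
by exists Q => z1; rewrite -QE.
Qed.

Lemma prod_coord2 (P : mpoly (n1 + n2) K) z1 : exists Q : mpoly n2 K,
  forall z2, ev (u2 z2) Q = ev (prod_coord (z1, z2)) P.
Proof.
have [|Q QE] := @polyfn_comp K n2 (n1 + n2) P
    (fun i v => if (i < n1)%N then u1 z1 i else v (i - n1)%N).
  move=> i lt; have [_|ge] := ltnP i n1; first exact: polyfnC.
  by apply: polyfnX; rewrite ltn_subLR.
by exists Q => z2; rewrite -QE.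
Qed.

Lemma vanishN T (n : nat) (u : T -> nat -> K) (Z : set T) (P : mpoly n K) :
  ~ vanish u Z P -> exists2 z, Z z & ev (u z) P != 0.
Proof.
move=> nv; apply: contrapT => no; apply: nv => z Zz; apply/eqP.
by apply: contrapT => /negP nz; apply: no; exists z.
Qed.

Lemma prime_on_nz T (n : nat) (u : T -> nat -> K) (Z : set T) (P Q : mpoly n K) :
  prime_on n u Z -> (exists2 z, Z z & ev (u z) P != 0) ->
  (exists2 z, Z z & ev (u z) Q != 0) ->
  exists2 z, Z z & ev (u z) P != 0 /\ ev (u z) Q != 0.
Proof.
move=> [_ pZ] [z1 Z1 P1] [z2 Z2 Q2].
have /vanishN[z Zz] : ~ vanish u Z (P * Q).
  by case/pZ => [/(_ z1 Z1)/eqP|/(_ z2 Z2)/eqP]; apply/negP.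
by rewrite rmorphM mulf_eq0 negb_or => /andP[]; exists z.
Qed.

(** If [P] and [Q] are nonzero at [a] and [b], find first a common second component and
    then a common first component where both are nonzero. *)
Lemma prime_on_prod Z1 Z2 : prime_on n1 u1 Z1 -> prime_on n2 u2 Z2 ->
  prime_on (n1 + n2) prod_coord (Z1 `*` Z2).
Proof.
move=> p1 p2; split.
  by have [z1 Zz1] := p1.1; have [z2 Zz2] := p2.1; exists (z1, z2).
move=> P Q PQ; apply: contrapT => /not_orP[/vanishN[[a1 a2] [/= Za1 Za2] Pa]].
move=> /vanishN[[b1 b2] [/= Zb1 Zb2] Qb].
have [Pa1 Pa1E] := prod_coord2 P a1; have [Qb1 Qb1E] := prod_coord2 Q b1.
have [z2 Zz2 [Pz2 Qz2]] : exists2 z, Z2 z & ev (u2 z) Pa1 != 0 /\ ev (u2 z) Qb1 != 0.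
  apply: prime_on_nz => //; first by exists a2; rewrite ?Pa1E.
  by exists b2; rewrite ?Qb1E.
have [P2 P2E] := prod_coord1 P z2; have [Q2 Q2E] := prod_coord1 Q z2.
have [z1 Zz1 [Pz Qz]] : exists2 z, Z1 z & ev (u1 z) P2 != 0 /\ ev (u1 z) Q2 != 0.
  apply: prime_on_nz => //; first by exists a1; rewrite ?P2E -?Pa1E.
  by exists b1; rewrite ?Q2E -?Qb1E.
have /eqP := PQ (z1, z2) (conj Zz1 Zz2).
by rewrite rmorphM /= -P2E -Q2E mulf_eq0 (negbTE Pz) (negbTE Qz).
Qed.

End ProductCoordinates.

(** * The generic rank of a family of maps *)

Section GenericRank.
Context {K : closedFieldType} {TG TX : Type}.
Variables (n1 n2 n3 : nat) (cg : TG -> nat -> K) (cx : TX -> nat -> K).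
Variables (F : TG -> TX -> nat -> K) (A : set TG) (B : set TX).
Variables (q : mpoly (n1 + n2) K) (p : nat -> mpoly (n1 + n2) K).
Let u := prod_coord n1 cg cx.
Hypotheses (pA : prime_on n1 cg A) (pB : prime_on n2 cx B).
Hypothesis q_nv : ~ vanish u (A `*` B) q.
Hypothesis Fq : forall g x, A g -> B x -> ev (u (g, x)) q != 0 ->
  forall k, (k < n3)%N -> F g x k * ev (u (g, x)) q = ev (u (g, x)) (p k).

(** The points [g] where [F g x] is given by the quotients [p k / q]. *)
Definition fiber x := [set g | A g /\ ev (u (g, x)) q != 0].

Lemma eq_indep T n (f f' : T -> nat -> K) (Z : set T) :
  (forall z k, Z z -> (k < n)%N -> f z k = f' z k) -> indep f n Z -> indep f' n Z.
Proof.
move=> e iZ P vP; apply: iZ => z Zz; rewrite -(vP z Zz).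
by apply: eq_ev => k kn; apply: e.
Qed.

Let s := (n1 + n2 + n3)%N.
Let y (z : TG * TX) i := if (i < n1 + n2)%N then u z i else F z.1 z.2 (i - (n1 + n2)).
Let D := [set z | (A `*` B) z /\ ev (u z) q != 0].
Let Ig := [set i : 'I_s | (i < n1)%N]%SET.
Let Ix := [set i : 'I_s | (n1 <= i < n1 + n2)%N]%SET.
Let IF := [set i : 'I_s | (n1 + n2 <= i)%N]%SET.

Let pDu : prime_on (n1 + n2) u D.
Proof. by apply: prime_on_open => //; apply: prime_on_prod. Qed.

Let pD : prime_on s y D.
Proof.
apply: (prime_on_rational pDu (q := q)) => [z []//|i si].
have [lt|ge] := ltnP i (n1 + n2).
  by exists (mpolyX K (mnm1 (Ordinal lt)) * q) => z _; rewrite /y lt rmorphM /= evX.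
exists (p (i - (n1 + n2))) => -[g x] [[Ag Bx] qz].
by rewrite /y ltnNge ge /= Fq //; rewrite ltn_subLR.
Qed.

Let fiber_prime x : B x -> fiber x !=set0 ->
  prime_on n1 cg (fiber x) /\ prime_on s (fun g => y (g, x)) (fiber x).
Proof.
move=> Bx [g0 [Ag0 qg0]]; have [qx qxE] := prod_coord1 cg cx q x.
have fE : fiber x = [set g | A g /\ ev (cg g) qx != 0].
  by apply/seteqP; split=> g /=; rewrite /fiber /= qxE.
have p1 : prime_on n1 cg (fiber x).
  rewrite fE; apply: prime_on_open => // /(_ g0 Ag0) /eqP.
  by rewrite qxE (negbTE qg0).
split=> //; apply: (prime_on_rational p1 (q := qx)).
  by move=> g [_]; rewrite qxE.
move=> i si; have [lt1|ge1] := ltnP i n1.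
  exists (mpolyX K (mnm1 (Ordinal lt1)) * qx) => g _.
  rewrite /y (leq_trans lt1 (leq_addr _ _)) rmorphM /= evX.
  by rewrite /u /prod_coord lt1.
have [lt|ge] := ltnP i (n1 + n2).
  exists (mpolyC _ (cx x (i - n1)) * qx) => g _.
  by rewrite /y lt rmorphM /= evC /u /prod_coord ltnNge ge1.
have [px pxE] := prod_coord1 cg cx (p (i - (n1 + n2))) x.
exists px => g [Ag qg]; rewrite pxE qxE /y ltnNge ge /= Fq //.
by rewrite ltn_subLR.
Qed.

(** The sets [B0], [Phi] and [W] (the union of [Phi] and [Theta]) are those of the
    introduction; [Ga] is a set of [g]-coordinates that is maximal independent
    over [B0]. *)
Theorem generic_rank : exists d (b : mpoly n2 K), ~ vanish cx B b /\
  forall x, B x -> ev (cx x) b != 0 ->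
  [/\ fiber x !=set0,
      forall k (f : nat -> mpoly n3 K),
        indep (fun g l => ev (F g x) (f l)) k (fiber x) -> (k <= d)%N &
      exists phi : nat -> nat, (forall l, (l < d)%N -> (phi l < n3)%N) /\
        indep (fun g l => F g x (phi l)) d (fiber x)].
Proof.
have [B0 [_ B0x iB0 aB0]] := maximal_indep pD (indep_vars0 pD) (finset.sub0set Ix).
have [A1 [B0A1 A1s iA1 aA1]] := maximal_indep pD iB0 (finset.subsetUl B0 IF).
have [A2 [A1A2 A2s iA2 aA2]] := maximal_indep pD iA1 (finset.subsetUl A1 Ig).
have [A3 [B0A3 A3s iA3 aA3]] := maximal_indep pD iB0 (finset.subsetUl B0 Ig).
have B0A2 := fintype.subset_trans B0A1 A1A2.
pose R i := if i \in Ig then A2 else A1.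
have alg i : algebraic_over y D (R i) (fun z => y z i).
  rewrite /R; case: ifPn => [ig|nig].
    by apply: aA2; rewrite inE ig orbT.
  have [ix|nix] := boolP (i \in Ix); first exact: algebraic_over_sub B0A1 (aB0 i ix).
  apply: aA1; rewrite inE; apply/orP; right; move: nig nix; rewrite !inE; lia.
(* In turn, [x], [g] and [F] become algebraic over [A3], the last since it is
   rational in [(g, x)]. *)
have A23 : (#|A2| <= #|A3|)%N.
  have g1 := growth_variables pD A3.
  have g2 := growth_union pD g1 (J' := Ix) (fun i ix => algebraic_over_sub B0A3 (aB0 i ix)).
  have g3 := growth_union pD g2 (J' := Ig).
  have {}g3 : growth y D #|A3| (Ig :|: (Ix :|: A3)).
    apply: g3 => i ig; apply: (@algebraic_over_sub _ _ _ _ _ A3); first exact: finset.subsetUr.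
    by apply: aA3; rewrite inE ig orbT.
  have {}g3 : growth y D #|A3| (IF :|: (Ig :|: (Ix :|: A3))).
    apply: growth_union => // i; rewrite inE => ige.
    have [qs qsE] := ev_widen q (leq_addr n3 (n1 + n2)).
    have [ps psE] := ev_widen (p (i - (n1 + n2))) (leq_addr n3 (n1 + n2)).
    have dep (P : mpoly (n1 + n2) K) (Q : mpoly s K) : (forall v, ev v Q = ev v P) ->
        depends (Ig :|: (Ix :|: A3)) Q.
      move=> QP v w vw; rewrite !QP; apply: eq_ev => j lt.
      have js : (j < s)%N by apply: leq_trans lt (leq_addr _ _).
      by apply: (vw (Ordinal js)); rewrite !inE /= lt andbT; case: ltnP.
    have yu z (P : mpoly (n1 + n2) K) (Q : mpoly s K) : (forall v, ev v Q = ev v P) ->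
        ev (y z) Q = ev (u z) P.
      by move=> ->; apply: eq_ev => j lt; rewrite /y lt.
    have lcE : lead_coef (qs *: 'X - ps%:P) = qs.
      have qs0 : qs != 0.
        apply: contra_not_neq q_nv => e z _; apply/eqP; rewrite -(yu z q qs qsE) e rmorph0 //.
      rewrite lead_coefDl ?lead_coefZ ?lead_coefX ?mulr1 //.
      by rewrite size_polyN size_scale // size_polyX size_polyC ltnS leq_b1.
    exists (qs *: 'X - ps%:P); split.
    - move=> l; rewrite coefB coefZ coefX coefC; apply: dependsB.
        case: (l == 1%N); first by rewrite mulr1; apply: dep qsE.
        by rewrite mulr0 -mpolyC0; apply: dependsC.
      by case: ifP => _; [apply: dep psE|rewrite -mpolyC0; apply: dependsC].
    - rewrite lcE; have [z Dz] := pD.1; move=> /(_ z Dz) /eqP.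
      by rewrite (yu z q qs qsE) (negbTE Dz.2).
    - move=> [g x] Dz; rewrite rmorphB /= -mul_polyC rmorphM /= map_polyX !map_polyC /=.
      rewrite !hornerE (yu _ _ _ qsE) (yu _ _ _ psE) /y ltnNge ige /= mulrC Fq ?subrr //.
      + by case: Dz => -[].
      + by case: Dz => -[].
      + by case: Dz.
      + by rewrite ltn_subLR.
  apply: (growth_card pD g3) => //; apply/fintype.subsetP => i _; rewrite !inE.
  by have [h|h] := leqP (n1 + n2) i; have [h1|h1] := ltnP i n1.
pose W := (A2 :\: B0)%SET; pose Ga := (A3 :\: B0)%SET; pose Phi := (A1 :\: B0)%SET.
have WGa : (#|W| <= #|Ga|)%N.
  by rewrite !cardsDS // leq_sub2r.
have PhiIF : Phi \subset IF.
  apply/fintype.subsetP => i; rewrite inE => /andP[nB0 /(fintype.subsetP A1s)].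
  by rewrite inE (negbTE nB0).
have PhiW : Phi \subset W by apply: finset.setSD.
have GaIg : Ga \subset Ig.
  apply/fintype.subsetP => i; rewrite inE => /andP[nB0 /(fintype.subsetP A3s)].
  by rewrite inE (negbTE nB0).
have A1x : A1 \subset Ix :|: Phi.
  apply/fintype.subsetP => i iA; rewrite inE; apply/orP.
  have [/(fintype.subsetP B0x)|nB] := boolP (i \in B0); first by left.
  by right; rewrite inE nB.
have A2x : A2 \subset Ix :|: W.
  apply/fintype.subsetP => i iA; rewrite inE; apply/orP.
  have [/(fintype.subsetP B0x)|nB] := boolP (i \in B0); first by left.
  by right; rewrite inE nB.
have /choice[pr prP] := alg.
(* The relations specialise at [x] if their leading coefficients do not vanish
   identically there; it is enough to ask this at one point [g0]. *)
pose La := \prod_i lead_coef (pr i).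
have nvLa : ~ vanish y D La.
  rewrite /La; elim/big_rec: _ => [|i P _ nP].
    by have [z Dz] := pD.1; move=> /(_ z Dz) /eqP; rewrite rmorph1 oner_eq0.
  by case/pD.2 => //; case: (prP i).
have [M [Rd RdE]] : exists M (Rd : mpoly (n1 + n2) K), forall z, D z ->
    ev (y z) La * ev (u z) q ^+ M = ev (u z) Rd.
  apply: (@clear_denominators _ _ _ s u y D q) => i si.
  have [lt|ge] := ltnP i (n1 + n2).
    by exists (mpolyX K (mnm1 (Ordinal lt)) * q) => z _; rewrite /y lt rmorphM /= evX.
  exists (p (i - (n1 + n2))) => -[g x] [[Ag Bx] qz].
  by rewrite /y ltnNge ge /= Fq //; rewrite ltn_subLR.
have [[g0 x0] Dz0 La0] := vanishN nvLa.
have [b bE] := prod_coord2 cg cx (Rd * q) g0.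
have [[Ag0 Bx0] q0] := Dz0; rewrite /= in Ag0 Bx0.
exists #|Phi|, b; split.
  move=> /(_ x0 Bx0) /eqP; rewrite bE rmorphM /= -/u -RdE // !mulf_eq0 expf_eq0.
  by rewrite (negbTE La0) (negbTE q0) andbF.
move=> x Bx; rewrite bE rmorphM /= -/u mulf_eq0 negb_or => /andP[Rx qx].
have Dx : D (g0, x) by [].
have Lax : ev (y (g0, x)) La != 0.
  by apply: contraNneq Rx => L0; rewrite -RdE // L0 mul0r.
have fx : fiber x g0 by [].
have fx0 : fiber x !=set0 by exists g0.
have [pf py] := fiber_prime Bx fx0.
pose yx g := y (g, x).
have algx i : algebraic_over yx (fiber x) (R i) (fun g => yx g i).
  have [prd prl pre] := prP i; exists (pr i); split=> //.
    move=> /(_ g0 fx) /eqP; apply/negP; apply: contraNneq Lax => l0.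
    by rewrite rmorph_prod (bigD1 i) //= l0 mul0r.
  by move=> g [Ag qg]; apply: pre.
have algc (J : {set 'I_s}) (i : 'I_s) : i \in Ix -> algebraic_over yx (fiber x) J (fun g => yx g i).
  rewrite inE => /andP[i1 i2]; exists ('X - (mpolyC s (cx x (i - n1)))%:P); split.
  - move=> l; rewrite coefB coefX coefC; apply: dependsB.
      by rewrite -mpolyC_nat; apply: dependsC.
    by case: ifP => _; [|rewrite -mpolyC0]; apply: dependsC.
  - rewrite lead_coefXsubC => /(_ g0 fx) /eqP; by rewrite rmorph1 oner_eq0.
  - move=> g _; rewrite rmorphB /= map_polyX map_polyC /= evC !hornerE.
    by rewrite /yx /y i2 /u /prod_coord ltnNge i1 subrr.
have [Mx [_ MW iM aM]] := maximal_indep py (indep_vars0 py) (finset.sub0set W).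
(* Relations between [g]-coordinates do not depend on [x]. *)
have iGa : indep_vars yx (fiber x) Ga.
  move=> P dP vP; apply: (indep_vars_sub (finset.subsetDl A3 B0) iA3) => //.
  have [Q QE] : polyfn n1 (fun v => ev (fun i => if (i < n1)%N then v i else 0) P).
    apply: (polyfn_comp P (r := fun i v => if (i < n1)%N then v i else 0)) => i _.
    by have [lt|_] := ltnP i n1; [exact: polyfnX|exact: polyfnC].
  have PQ z : ev (y z) P = ev (cg z.1) Q.
    rewrite -QE; apply: dP => i /(fintype.subsetP GaIg); rewrite inE => lt.
    by rewrite lt /y (leq_trans lt (leq_addr _ _)) /u /prod_coord lt.
  have [qx' qxE] := prod_coord1 cg cx q x.
  have [g Ag|vQ|vq] := pA.2 Q qx'.
  - have [qg|qg] := eqVneq (ev (cg g) qx') 0; first by rewrite rmorphM /= qg mulr0.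
    rewrite rmorphM /= -[ev (cg g) Q](PQ (g, x)) vP ?mul0r //; split=> //.
    by rewrite -qxE.
  - by move=> [g x'] [[Ag _] _]; rewrite PQ; apply: vQ.
  - by have /eqP := vq g0 Ag0; rewrite qxE -/u (negbTE qx).
(* A maximal independent part of [W] at [x] still spans the [g]-coordinates. *)
have MWe : Mx = W.
  apply/eqP; rewrite eqEcard MW (leq_trans WGa) //.
  have g1 := growth_variables py Mx.
  have g2 := growth_union py g1 aM.
  have g3 := growth_union py g2 (fun i => @algc (W :|: Mx) i).
  have g4 : growth yx (fiber x) #|Mx| (Ig :|: (Ix :|: (W :|: Mx))).
    apply: growth_union => // i ig; have := algx i; rewrite /R ig.
    apply: algebraic_over_sub; apply: fintype.subset_trans A2x _.
    by apply: finset.setUS; apply: finset.subsetUl.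
  apply: (growth_card py g4) => //; apply: fintype.subset_trans GaIg _.
  exact: finset.subsetUl.
have iPhi : indep_vars yx (fiber x) Phi.
  by apply: indep_vars_sub PhiW _; rewrite -MWe.
split=> //.
- move=> k f fi; have g1 := growth_variables py Phi.
  have g2 := growth_union py g1 (fun i => @algc Phi i).
  have g3 : growth yx (fiber x) #|Phi| (IF :|: (Ix :|: Phi)).
    apply: growth_union => // i iF; have := algx i; rewrite /R ifF.
      exact: algebraic_over_sub.
    by move: iF; rewrite !inE => ge; apply/negbTE; rewrite -leqNgt (leq_trans (leq_addr _ _) ge).
  have /choice[f' f'E] : forall l, exists Q : mpoly s K,
      forall v, ev v Q = ev (fun i => v (n1 + n2 + i)%N) (f l).
    move=> l; have [|Q QE] := @polyfn_comp K s n3 (f l) (fun i v => v (n1 + n2 + i)%N).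
      by move=> i i3; apply: polyfnX; rewrite ltn_add2l.
    by exists Q => v; rewrite -QE.
  apply: (growth_bound (f := f') py g3) => [i _|].
    move=> v w vw; rewrite !f'E; apply: eq_ev => j j3.
    have js : (n1 + n2 + j < s)%N by rewrite ltn_add2l.
    by apply: (vw (Ordinal js)); rewrite !inE /= leq_addr.
  apply: eq_indep fi => g l _ _; rewrite f'E; apply: eq_ev => i i3.
  by rewrite /yx /y ltnNge leq_addr /= addKn.
- have vP l : (l < #|Phi|)%N -> (n1 + n2 <= var_nth Phi l < s)%N.
    move=> lP; have [i iP ->] := var_nthP lP; rewrite ltn_ord andbT.
    by have := fintype.subsetP PhiIF i iP; rewrite inE.
  exists (fun l => var_nth Phi l - (n1 + n2))%N; split.
    by move=> l /vP /andP[ge lt]; rewrite ltn_subLR.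
  apply: eq_indep (indep_var_nth iPhi) => g l _ /vP /andP[ge lt].
  by rewrite /yx /y ltnNge ge.
Qed.

End GenericRank.

(** * Irreducible sets and Krull dimension *)

Section ExtendedIntegers.
Local Open Scope ereal_scope.
Implicit Types (S : set (\bar int)).

Lemma bounded_supremum (I : set int) (b : int) :
  I !=set0 -> (forall r, I r -> (r <= b)%R) -> exists2 m, I m & forall r, I r -> (r <= m)%R.
Proof.
move=> [r0 Ir0] ub.
have ex : exists n, `[< exists2 r, I r & (b - r = n%:Z)%R >].
  exists `|b - r0|%N; apply/asboolP; exists r0 => //.
  by have := ub _ Ir0; lia.
case: (ex_minnP ex) => n /asboolP[m Im e] nmin; exists m => // r Ir.
have /nmin : `[< exists2 r', I r' & (b - r' = `|b - r|%N%:Z)%R >].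
  by apply/asboolP; exists r => //; have := ub _ Ir; lia.
by have := ub _ Ir; lia.
Qed.

(** Either the set is unbounded and has supremum [+oo], or it is reduced to [-oo], or
    its finite elements have a maximum. *)
Lemma supremums_neq0 S : S !=set0 -> supremums S !=set0.
Proof.
move=> [s0 Ss0].
have [uS|nuS] := pselect (forall b : int, exists2 s, S s & b%:E < s).
  exists +oo; split=> [s _|b ub]; first exact: leey.
  case: b ub => [r| |] ub //.
  - by have [s Ss] := uS r; rewrite ltNge (ub s Ss).
  - by have [s Ss] := uS 0%R; case: s Ss => [r /ub|/ub|] //=.
have [b bP] : exists b : int, forall s, S s -> s <= b%:E.
  apply: contrapT => /forallNP nb; apply: nuS => b.
  have /existsNP[s /not_implyP[Ss sb]] := nb b.
  by exists s => //; rewrite ltNge; apply/negP.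
have [[r Sr]|nS] := pselect (exists r : int, S r%:E).
  have [m Sm mP] := @bounded_supremum [set r | S r%:E] b (ex_intro _ r Sr)
     (fun r (Sr : S r%:E) => bP _ Sr).
  exists m%:E; split=> [s Ss|c cP]; last exact: cP.
  case: s Ss => [t St|/bP//|_]; [by rewrite lee_fin; apply: mP|exact: leNye].
exists -oo; split=> [s Ss|c _]; last exact: leNye.
case: s Ss => [t St|/bP//|_] //; by case: nS; exists t.
Qed.

Lemma supremum_ub x0 S s : S s -> s <= supremum x0 S.
Proof.
move=> Ss; rewrite /supremum ifF; last first.
  by apply/eqP => S0; rewrite S0 in Ss.
have [m mP] : supremums S !=set0 by apply: supremums_neq0; exists s.
by case: xgetP => [_ -> [ub _]|/(_ m)//]; apply: ub.
Qed.

Lemma supremum_le x0 S c : S !=set0 -> (forall s, S s -> s <= c) -> supremum x0 S <= c.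
Proof.
move=> S0 cP; rewrite /supremum ifF; last by apply/negbTE/set0P.
have [m mP] := supremums_neq0 S0.
by case: xgetP => [_ -> [_ lb]|/(_ m)//]; apply: lb.
Qed.

Lemma supremum_max x0 S s : S s -> (forall t, S t -> t <= s) -> supremum x0 S = s.
Proof.
move=> Ss sP; apply/eqP; rewrite eq_le supremum_ub // andbT.
by apply: supremum_le => //; exists s.
Qed.

Lemma le_infimum x0 S c : S !=set0 -> (forall s, S s -> c <= s) -> c <= infimum x0 S.
Proof.
move=> S0 cP; rewrite /infimum ifF; last by apply/negbTE/set0P.
have [m [mub mlb]] : supremums (lbound S) !=set0.
  by apply: supremums_neq0; exists -oo => s _; exact: leNye.
have mi : infimums S m by split=> // s Ss; apply: mlb => l; apply.
by case: xgetP => [_ -> [_ ub]|/(_ m)//]; apply: ub.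
Qed.

End ExtendedIntegers.

Section Irreducible.
Context {T : topologicalType}.
Implicit Types (W A B F : set T).

Lemma closure_sub A F : closed F -> A `<=` F -> closure A `<=` F.
Proof. by move=> cF AF; rewrite closureE; apply: smallest_sub. Qed.

Lemma irreducible_closure A (Z : set T) : irreducible_set A -> A `<=` Z -> Z `<=` closure A ->
  irreducible_set Z.
Proof.
move=> [[a Aa] irr] AZ ZA; split; first by exists a; apply: AZ.
move=> F1 F2 c1 c2 ZF.
have sub F : closed F -> A `<=` F -> Z `<=` F.
  by move=> cF AF; apply: subset_trans ZA _; apply: closure_sub.
by have [/sub|/sub] := irr F1 F2 c1 c2 (subset_trans AZ ZF); [left|right]; auto.
Qed.

Lemma irreducible_open A W : irreducible_set A -> open W -> A `&` W !=set0 ->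
  irreducible_set (A `&` W) /\ forall F, closed F -> A `&` W `<=` F -> A `<=` F.
Proof.
move=> [_ irr] oW [a [Aa Wa]].
have dns F : closed F -> A `&` W `<=` F -> A `<=` F.
  move=> cF AF; have [||//|AW] := irr F (~` W) cF; first exact: open_closedC.
    by move=> x Ax; have [Wx|] := pselect (W x); [left; apply: AF|right].
  by have := AW a Aa.
split=> //; split; first by exists a.
move=> F1 F2 c1 c2 AF.
have [|h|h] := irr F1 F2 c1 c2.
- by apply: dns => //; apply: closedU.
- by left=> x [Ax _]; apply: h.
- by right=> x [Ax _]; apply: h.
Qed.

Lemma irreducible_finite_cover (J : finType) (F : J -> set T) Z :
  irreducible_set Z -> (forall j, closed (F j)) ->
  (forall z, Z z -> exists j, F j z) -> exists j, Z `<=` F j.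
Proof.
move=> [[z0 Zz0] irr] cF ZF.
suff H (s : seq J) : Z `<=` \big[setU/set0]_(j <- s) F j -> exists j, Z `<=` F j.
  apply: (H (enum J)) => z /ZF[j Fj]; rewrite -bigcup_seq.
  by exists j => //=; rewrite mem_enum.
elim: s => [|j s IH]; first by rewrite big_nil => /(_ z0 Zz0).
rewrite big_cons => /irr[//||ZF'|/IH//]; last by exists j.
by apply: closed_bigsetU.
Qed.

(** By Zorn's lemma: the union of a chain of irreducible sets is irreducible. The empty
    set is admitted in [P] because the empty chain has to have an upper bound. *)
Lemma irreducible_component_ex W A : irreducible_set A -> A `<=` W ->
  exists2 Z, irreducible_component W Z & A `<=` Z.
Proof.
move=> iA AW; have [[a Aa] _] := iA.
pose P Z := Z = set0 \/ [/\ irreducible_set Z, A `<=` Z & Z `<=` W].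
have [F FP totF|Z [[Z0|[iZ AZ ZW]] Zmax]] := @Zorn_bigcup _ P.
- have [allE|] := pselect (forall X, F X -> X = set0).
    left; apply/seteqP; split=> // x [X FX Xx].
    by have := allE X FX => X0; rewrite X0 in Xx.
  move=> /existsNP[X /not_implyP[FX X0]]; right.
  have irrF Y y : F Y -> Y y -> [/\ irreducible_set Y, A `<=` Y & Y `<=` W].
    by move=> /FP[->|//].
  have {X0} [x Xx] : X !=set0 by apply/set0P/eqP.
  have [iX AX XW] := irrF X x FX Xx.
  split; last by move=> y [Y FY Yy]; have [_ _] := irrF Y y FY Yy; apply.
  + split; first by exists x, X.
    move=> F1 F2 c1 c2 UF; apply: contrapT => /not_orP[].
    move=> /existsNP[y1 /not_implyP[[Y1 FY1 Yy1] ny1]].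
    move=> /existsNP[y2 /not_implyP[[Y2 FY2 Yy2] ny2]].
    have sub Y : F Y -> Y `<=` F1 `|` F2 by move=> FY y Yy; apply: UF; exists Y.
    have [Y12|Y21] := totF Y1 Y2 FY1 FY2.
    * have [[_ irr] _ _] := irrF Y2 y2 FY2 Yy2.
      by have [/(_ y1 (Y12 y1 Yy1))|/(_ y2 Yy2)] := irr F1 F2 c1 c2 (sub Y2 FY2).
    * have [[_ irr] _ _] := irrF Y1 y1 FY1 Yy1.
      by have [/(_ y1 Yy1)|/(_ y2 (Y21 y2 Yy2))] := irr F1 F2 c1 c2 (sub Y1 FY1).
  + by move=> z Az; exists X => //; apply: AX.
- exfalso; apply: (Zmax A); last by right; split.
  by rewrite Z0; split=> // /(_ a Aa).
- exists Z => //; split=> // Z' iZ' ZZ' Z'W.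
  apply: contrapT => ne; apply: (Zmax Z'); last first.
    by right; split=> //; apply: subset_trans ZZ'.
  by split=> // Z'Z; apply: ne; apply/seteqP.
Qed.

(** The closed sets [C k] guarantee that the closures of the [E k] remain distinct. *)
Lemma chain_of_separated W d (E C : nat -> set T) :
  (forall k, (k <= d)%N -> irreducible_set (E k) /\ E k `<=` W) ->
  (forall k, (k < d)%N -> E k `<=` E k.+1) ->
  (forall k, (k < d)%N -> [/\ closed (C k), E k `<=` C k & ~ E k.+1 `<=` C k]) ->
  irreducible_chain W d (fun k => W `&` closure (E k)).
Proof.
move=> iE sE sC; split=> [k kd|k kd].
  have [irr EW] := iE k kd; split; last by exists (closure (E k)) => //; apply: closed_closure.
  apply: irreducible_closure irr _ _; last by move=> x [].
  by move=> x Ex; split; [apply: EW|apply: subset_closure].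
have [cC EC nEC] := sC k kd; split.
  by move=> x [Wx clx]; split=> //; apply: closureS clx; apply: sE.
move=> sub; apply: nEC => x Ex.
have [] : (W `&` closure (E k)) x.
  by apply: sub; split; [apply: (iE k.+1 kd).2|apply: subset_closure].
by move=> _ /(closure_sub cC EC).
Qed.

Lemma krull_dim_ge W n (Z : nat -> set T) : irreducible_chain W n Z -> (n%:Z%:E <= krull_dim W)%E.
Proof. by move=> ch; apply: supremum_ub; exists n => //; exists Z. Qed.

Lemma krull_dim_le W W' : (forall n (Z : nat -> set T), irreducible_chain W n Z ->
  exists Z' : nat -> set T, irreducible_chain W' n Z') -> (krull_dim W <= krull_dim W')%E.
Proof.
move=> ch; have [[s [n [Z nZ] _]]|no] := pselect
    ([set n%:Z%:E | n in [set n : nat | exists Z, irreducible_chain W n Z]] !=set0).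
  apply: supremum_le; first by exists n%:Z%:E, n => //; exists Z.
  by move=> _ [m [Z1 /ch[Z2 ch2]] <-]; apply: krull_dim_ge ch2.
rewrite /krull_dim (_ : image _ _ = set0) ?supremum0 ?leNye //.
by apply/seteqP; split=> // x Sx; apply: no; exists x.
Qed.

Lemma krull_dim_eq W n (Z : nat -> set T) : irreducible_chain W n Z ->
  (forall m (Z' : nat -> set T), irreducible_chain W m Z' -> (m <= n)%N) -> krull_dim W = n%:Z%:E.
Proof.
move=> ch nP; apply: supremum_max; first by exists n => //; exists Z.
by move=> _ [m [Z1 ch1] <-]; rewrite lee_fin lez_nat; apply: nP ch1.
Qed.

End Irreducible.

Lemma irreducible_image (S T : topologicalType) (f : S -> T) (A : set S) :
  continuous f -> irreducible_set A -> irreducible_set (f @` A).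
Proof.
move=> /continuous_closedP cf [[a Aa] irr]; split; first by exists (f a), a.
move=> F1 F2 c1 c2 AF.
have [||x Ax|h|h] := irr (f @^-1` F1) (f @^-1` F2); try exact: cf.
- exact: (AF (f x) (ex_intro2 _ _ x Ax erefl)).
- by left=> _ [x Ax <-]; apply: h.
- by right=> _ [x Ax <-]; apply: h.
Qed.

(** * Charts *)

Section RowCoordinates.
Context {K : closedFieldType}.

Definition row_coord n (v : 'rV[K]_n) (k : nat) : K :=
  if insub k is Some i then v ord0 i else 0.

Lemma row_coordE n (v : 'rV[K]_n) (i : 'I_n) : row_coord v i = v ord0 i.
Proof. by rewrite /row_coord valK. Qed.

Lemma ev_row_coord n (v : 'rV[K]_n) (P : mpoly n K) : ev (row_coord v) P = peval P v.
Proof. by apply: meval_eq => i; apply: row_coordE. Qed.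

Lemma row_coord_mx n1 n2 (v1 : 'rV[K]_n1) (v2 : 'rV[K]_n2) k : (k < n1 + n2)%N ->
  row_coord (row_mx v1 v2) k =
  if (k < n1)%N then row_coord v1 k else row_coord v2 (k - n1).
Proof.
suff H (o : 'I_(n1 + n2)) : row_coord (row_mx v1 v2) o =
    if (o < n1)%N then row_coord v1 o else row_coord v2 (o - n1).
  by move=> kn; apply: (H (Ordinal kn)).
rewrite row_coordE -[o]fintype.splitK; case: (fintype.split o) => [i|i] /=.
  by rewrite row_mxEl ltn_ord row_coordE.
by rewrite row_mxEr ltnNge leq_addr /= addKn row_coordE.
Qed.

End RowCoordinates.

Section Atlas.
Context {K : closedFieldType} {T : choiceType} (A : atlas K T).
Implicit Types (W F : set (zspace A)) (x y : zspace A) (i j : chart_index A).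

Definition coord i (x : T) : nat -> K := row_coord (chart i x).

Lemma closed_trace F i : closed F -> exists S : set (mpoly (chart_dim i) K),
  forall x, chart_dom i x -> F x <-> forall P, S P -> ev (coord i x) P = 0.
Proof.
rewrite -openC openZariskiE => /(_ i)[S eS]; exists S => x ux.
have : (chart_dom i `&` ~` F) x <-> (chart_dom i `\` chart i @^-1` zeros S) x by rewrite eS.
move=> [h1 h2]; split=> [Fx P SP|SP].
  have : zeros S (chart i x).
    by apply: contrapT => nz; have [] := h2 (conj ux nz).
  by move=> /(_ P SP); rewrite ev_row_coord.
apply: contrapT => nF; have [_] := h1 (conj ux nF); apply=> P /SP.
by rewrite ev_row_coord.
Qed.

Lemma open_basis W i x : open W -> W x -> chart_dom i x ->
  exists P : mpoly (chart_dim i) K, ev (coord i x) P != 0 /\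
  forall y, chart_dom i y -> ev (coord i y) P != 0 -> W y.
Proof.
rewrite -closedC => /(closed_trace i)[S SP] Wx ux.
have : ~ (~` W) x by apply.
rewrite SP // => /existsNP[P /not_implyP[SP' /eqP Px]]; exists P; split=> //.
move=> y uy Py; apply: contrapT => nW; have /(SP y uy)/(_ P SP')/eqP := nW.
by rewrite (negbTE Py).
Qed.

(** Together with [open_basis]: the principal open sets of the charts form a basis. *)
Lemma open_of_basis W :
  (forall i x, chart_dom i x -> W x -> exists P : mpoly (chart_dim i) K,
    ev (coord i x) P != 0 /\ forall y, chart_dom i y -> ev (coord i y) P != 0 -> W y) ->
  open W.
Proof.
move=> H; rewrite openZariskiE => i.
exists [set P | forall y, chart_dom i y -> ev (coord i y) P != 0 -> W y].
apply/seteqP; split=> x /=; move=> [ux h]; split=> //.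
  have [P [Px PW]] := H i x ux h.
  by move=> /(_ P PW) /eqP; rewrite -ev_row_coord (negbTE Px).
apply: contrapT => nW; apply: h => P PW; rewrite -ev_row_coord; apply/eqP.
by apply: contrapT => /negP Px; apply: nW; apply: PW.
Qed.

(** The new denominator and the equation of the neighbourhood where it is valid are
    multiplied into the previous ones. *)
Lemma regular_quotient n (f : zspace A -> nat -> K) W i x :
  open W -> W x -> chart_dom i x ->
  (forall k, (k < n)%N -> regular_at (f^~ k) x) ->
  exists (q : mpoly (chart_dim i) K) (p : nat -> mpoly (chart_dim i) K),
    ev (coord i x) q != 0 /\
    forall y, chart_dom i y -> ev (coord i y) q != 0 ->
      W y /\ forall k, (k < n)%N -> f y k * ev (coord i y) q = ev (coord i y) (p k).
Proof.
move=> oW Wx ux; elim: n => [_|n IH freg].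
  have [P [Px PW]] := open_basis oW Wx ux.
  by exists P, (fun=> 0); split=> // y uy Py; split=> //; apply: PW.
have [|q [p [qx qp]]] := IH; first by move=> k kn; apply/freg/leqW.
have [pn [qn [qnx]]] := freg n (ltnSn n) i ux.
rewrite -nbhs_nearE nbhsE => -[V [oV Vx] VP]; have [r [rx rV]] := open_basis oV Vx ux.
exists (q * (qn * r)), (fun k => if k == n then pn * q * r else p k * (qn * r)).
have qnx' : ev (coord i x) qn != 0 by rewrite ev_row_coord; apply/eqP.
split; first by rewrite !rmorphM /= !mulf_neq0.
move=> y uy; rewrite !rmorphM /= !mulf_eq0 !negb_or => /and3P[qy qny ry].
have [Wy fq] := qp y uy qy; split=> // k; rewrite ltnS leq_eqVlt => /predU1P[->|kn].
  rewrite eqxx !rmorphM /= (VP y (rV y uy ry) uy) -!ev_row_coord -mulrA.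
  by rewrite -!mulrA [X in _ * X](_ : _ = ev (coord i y) q * ev (coord i y) r) //; field.
by rewrite ltn_eqF // !rmorphM /= mulrA fq.
Qed.

End Atlas.

Section VarietyTopology.
Context {K : closedFieldType} {T : choiceType} (A : atlas K T) (AP : is_variety A).
Implicit Types (W F : set (zspace A)) (x y : zspace A) (i : chart_index A).

Lemma coord_regular i x k : chart_dom i x -> (k < chart_dim i)%N ->
  regular_at (fun y : zspace A => coord i y k) x.
Proof.
move=> ux ki; have := chart_regular AP (Ordinal ki) ux.
by congr (regular_at _ _); apply: funext => y; rewrite -row_coordE.
Qed.

(** Seen in another chart [j], the coordinates of chart [i] are quotients of
    polynomials, and so is [P]; its numerator times the common denominator
    defines a neighbourhood. *)
Lemma open_principal i (P : mpoly (chart_dim i) K) :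
  open ([set x | chart_dom i x /\ ev (coord i x) P != 0] : set (zspace A)).
Proof.
apply: open_of_basis => j x uj [ui Px].
have [|q [p [qx qp]]] := regular_quotient (n := chart_dim i) (f := coord i) (chart_open AP i) ui uj.
  by move=> k; apply: coord_regular.
pose Z := [set y | chart_dom j y /\ ev (coord j y) q != 0].
have [|M [R RE]] := @clear_denominators K T _ _ (coord j) (coord i) Z q _ P.
  by move=> k ki; exists (p k) => y [uy qy]; have [_] := qp y uy qy; apply.
have Zx : Z x by [].
exists (R * q); split.
  by rewrite rmorphM /= -RE // !mulf_neq0 ?expf_neq0.
move=> y uy; rewrite rmorphM /= mulf_eq0 negb_or => /andP[Ry qy].
have Zy : Z y by []; have [ui' _] := qp y uy qy; split=> //.
by apply: contraNneq Ry => P0; rewrite -RE // P0 mul0r.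
Qed.

Lemma closed_principal i (P : mpoly (chart_dim i) K) :
  closed ([set x | chart_dom i x -> ev (coord i x) P = 0] : set (zspace A)).
Proof.
rewrite (_ : [set x | _] = ~` [set x | chart_dom i x /\ ev (coord i x) P != 0]).
  exact/open_closedC/open_principal.
apply/seteqP; split=> x /= => [h [/h -> /eqP//]|h ux].
by apply/eqP; apply: contrapT => /negP Px; apply: h.
Qed.

Lemma prime_irreducible i (Z : set (zspace A)) : Z `<=` chart_dom i ->
  prime_on (chart_dim i) (coord i) Z -> irreducible_set Z.
Proof.
move=> Zi [Z0 pZ]; split=> // F1 F2 /(closed_trace i)[S1 S1P] /(closed_trace i)[S2 S2P] ZF.
apply: contrapT => /not_orP[/existsNP[z1 /not_implyP[Zz1 n1]]].
move=> /existsNP[z2 /not_implyP[Zz2 n2]].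
move: n1 n2; rewrite S1P; last exact: Zi.
rewrite S2P; last exact: Zi.
move=> /existsNP[P /not_implyP[SP nP]] /existsNP[Q /not_implyP[SQ nQ]].
have [z Zz|/(_ z1 Zz1)//|/(_ z2 Zz2)//] := pZ P Q.
rewrite rmorphM /=; have uz := Zi z Zz.
by case: (ZF z Zz) => [/(S1P z uz)/(_ P SP)->|/(S2P z uz)/(_ Q SQ)->]; rewrite ?mul0r ?mulr0.
Qed.

Lemma irreducible_prime i (Z : set (zspace A)) : irreducible_set Z ->
  Z `&` chart_dom i !=set0 -> prime_on (chart_dim i) (coord i) (Z `&` chart_dom i).
Proof.
move=> [_ irr] Zi; split=> // P Q PQ.
have [z Zz|h|h] := irr _ _ (closed_principal (P := P)) (closed_principal (P := Q)).
- have [ui|nu] := pselect (chart_dom i z); last by left.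
  have /eqP := PQ z (conj Zz ui); rewrite rmorphM mulf_eq0.
  by case/orP => /eqP e; [left|right].
- by left=> z [Zz ui]; apply: h.
- by right=> z [Zz ui]; apply: h.
Qed.

Lemma closed_on_dom i : closed_on (chart_dim i) (coord i) (chart_dom i).
Proof.
move=> v vP; have [S eS] := chart_image AP i.
pose w : 'rV[K]_(chart_dim i) := \row_k v k.
have wv k : (k < chart_dim i)%N -> row_coord w k = v k.
  by move=> ki; rewrite -[k]/(nat_of_ord (Ordinal ki)) row_coordE mxE.
have : zeros S w.
  move=> P SP; rewrite -ev_row_coord (eq_ev (w := v)) //; apply: vP => z uz.
  rewrite ev_row_coord; have : zeros S (chart i z) by rewrite -eS; exists z.
  exact.
rewrite -eS => -[z uz zw]; exists z => // k ki.
by rewrite /coord zw wv.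
Qed.

(** Each chart is decomposed into finitely many irreducible closed parts. *)
Lemma variety_pieces : exists (J : finType) (ij : J -> chart_index A) (Z : J -> set (zspace A)),
  (forall j, [/\ Z j `<=` chart_dom (ij j), prime_on (chart_dim (ij j)) (coord (ij j)) (Z j) &
     closed_on (chart_dim (ij j)) (coord (ij j)) (Z j)]) /\
  forall x, exists j, Z j x.
Proof.
have dec i := @irreducible_decomposition K T (chart_dim i) (coord i) (chart_dom i).
have [r rP] := choice dec; have [Z ZP] := choice rP.
exists {i : chart_index A & 'I_(r i)}, (@tag _ _),
  (fun j => Z (tag j) (nat_of_ord (tagged j))).
split=> [[i l]|x] /=.
  have [/(_ l (ltn_ord l))[pZ [S eS]] e] := ZP i; split=> //.
    by move=> z Zz; apply/e; exists l.
  by rewrite eS; apply: closed_on_cut; apply: closed_on_dom.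
have [i ux] := chart_cover AP x; have [_ e] := ZP i.
have /e[l lr Zl] := ux.
by exists (Tagged (fun i => 'I_(r i)) (Ordinal lr)).
Qed.

End VarietyTopology.

(** * Chains in varieties *)

Section Chains.
Context {K : closedFieldType} {T : choiceType} (A : atlas K T) (AP : is_variety A).
Implicit Types (W F : set (zspace A)) (x y : zspace A) (i : chart_index A).

Lemma prime_on_transfer (n m : nat) (u y : T -> nat -> K) (Z : set T) :
  (forall R : mpoly n K, exists Q : mpoly m K, forall z, Z z -> ev (y z) Q = ev (u z) R) ->
  prime_on m y Z -> prime_on n u Z.
Proof.
move=> tr [Z0 pZ]; split=> // P Q PQ.
have [P' PE] := tr P; have [Q' QE] := tr Q.
have [z Zz|vP|vQ] := pZ P' Q'.
- by rewrite rmorphM /= PE // QE // -rmorphM /= PQ.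
- by left=> z Zz; rewrite -PE //; apply: vP.
- by right=> z Zz; rewrite -QE //; apply: vQ.
Qed.

(** The set [D] becomes affine with the additional coordinate [1 / q], and the functions
    [t], being quotients by [q], may be taken as first coordinates; then
    [slice_chain] applies. *)
Lemma fiber_chain i (Z : set (zspace A)) (q P : mpoly (chart_dim i) K) d
    (t : T -> nat -> K) (p : nat -> mpoly (chart_dim i) K)
    (D := [set z | Z z /\ ev (coord i z) q != 0]) :
  Z `<=` chart_dom i -> prime_on (chart_dim i) (coord i) Z ->
  closed_on (chart_dim i) (coord i) Z ->
  (forall z, D z -> forall k, (k < d)%N -> t z k * ev (coord i z) q = ev (coord i z) (p k)) ->
  indep t d D -> (exists2 z, D z & ev (coord i z) P != 0) ->
  exists (E : nat -> set (zspace A)) (c : nat -> K),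
    (forall k, (k <= d)%N -> irreducible_set (E k) /\
      E k `<=` [set z | D z /\ ev (coord i z) P != 0]) /\
    forall k, (k < d)%N -> [/\ E k `<=` E k.+1, forall z, E k z -> t z k = c k &
      exists2 z, E k.+1 z & t z k != c k].
Proof.
move=> Zi pZ cZ tq it [z0 Dz0 Pz0]; pose n := chart_dim i.
(* The functions [t], the chart coordinates, and the inverse of [q]. *)
pose y z k := if (k < d)%N then t z k else
  if (k < d + n)%N then coord i z (k - d) else (ev (coord i z) q)^-1.
have liftP (R : mpoly n K) : exists Q : mpoly (d + n).+1 K,
    (forall v, ev v Q = ev (fun k => v (d + k)%N) R) /\
    forall z, ev (y z) Q = ev (coord i z) R.
  have [|Q QE] := @polyfn_comp K (d + n).+1 n R (fun k v => v (d + k)%N).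
    by move=> k kn; apply: polyfnX; rewrite ltnS leq_add2l ltnW.
  exists Q; split=> [v|z]; rewrite -QE //; apply: eq_ev => k kn.
  by rewrite /y ltnNge leq_addr /= ltn_add2l kn addKn.
have pD : prime_on n (coord i) D.
  by apply: prime_on_open => // /(_ z0 Dz0.1) /eqP; rewrite (negbTE Dz0.2).
have pyD : prime_on (d + n).+1 y D.
  apply: (prime_on_rational pD (q := q)) => [z []//|k]; rewrite ltnS => kdn.
  have [kd|dk] := ltnP k d.
    by exists (p k) => z Dz; rewrite /y kd tq.
  have [lt|ge] := ltnP k (d + n).
    have lt' : (k - d < n)%N by rewrite ltn_subLR.
    exists (mpolyX K (mnm1 (Ordinal lt')) * q) => z _.
    by rewrite /y ltnNge dk /= lt rmorphM /= evX.
  exists 1 => z [_ qz]; rewrite /y ltnNge dk /= ltnNge ge /= rmorph1 mulVf //.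
have [qL [qLE1 qLE2]] := liftP q.
have cyD : closed_on (d + n).+1 y D.
  move=> v vP; pose w k := v (d + k)%N.
  have [|z Zz zw] := cZ w.
    move=> R vR; have [Q [Q1 Q2]] := liftP R; rewrite /w -Q1; apply: vP => z [Zz _].
    by rewrite Q2; apply: vR.
  have qzE : ev v qL = ev (coord i z) q.
    by rewrite qLE1; apply: eq_ev => k kn; rewrite zw.
  have vinv : v (d + n)%N * ev (coord i z) q = 1.
    apply/eqP; rewrite -subr_eq0; apply/eqP.
    rewrite -(vP (mpolyX K (mnm1 ord_max) * qL - 1)) => [|z' [_ qz']].
      by rewrite rmorphB rmorphM rmorph1 /= evX qzE.
    rewrite rmorphB rmorphM rmorph1 /= evX qLE2 /y /= ltnNge leq_addr /= ltnn mulVf //.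
    by rewrite subrr.
  have qz : ev (coord i z) q != 0.
    by apply: contra_eq_neq vinv => ->; rewrite mulr0 eq_sym oner_neq0.
  have Dz : D z by [].
  exists z => // k; rewrite ltnS => kdn.
  have [kd|dk] := ltnP k d.
    have [pL [pL1 pL2]] := liftP (p k).
    have kdn' : (k < (d + n).+1)%N by rewrite ltnS.
    rewrite /y kd; apply: (mulIf qz); rewrite tq //.
    apply/esym/eqP; rewrite -subr_eq0; apply/eqP.
    rewrite -(vP (mpolyX K (mnm1 (Ordinal kdn')) * qL - pL)) => [|z' Dz'].
      rewrite rmorphB rmorphM /= evX qzE pL1; congr (_ - _).
      by apply: eq_ev => l ln; rewrite zw.
    by rewrite rmorphB rmorphM /= evX qLE2 pL2 /y kd tq // subrr.
  have [lt|ge] := ltnP k (d + n).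
    by rewrite /y ltnNge dk /= lt zw ?ltn_subLR // /w subnKC.
  have -> : k = (d + n)%N by apply/eqP; rewrite eqn_leq kdn.
  rewrite /y ltnNge leq_addr /= ltnn; apply: (mulIf qz).
  by rewrite mulVf // vinv.
have iyD : indep y d D by apply: eq_indep it => z k _ kd; rewrite /y kd.
have [h [_ hE]] := liftP P.
have nh : ~ vanish y D h by move=> /(_ z0 Dz0) /eqP; rewrite hE (negbTE Pz0).
have dm : (d <= (d + n).+1)%N by rewrite leqW ?leq_addr.
have [E [c [_ Ep Ei Ec]]] := slice_chain dm pyD cyD iyD nh.
exists (fun k => [set z | E k z /\ ev (y z) h != 0]), c; split=> k kd.
  have [ED pE nhE] := Ep k kd; split; last first.
    by move=> z [/ED Dz]; rewrite hE.
  apply: (prime_irreducible (i := i)); first by move=> z [/ED[/Zi]].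
  apply: prime_on_transfer (prime_on_open pE nhE) => R.
  by have [Q [_ QE]] := liftP R; exists Q.
have [sE cE] := Ei k kd; split.
- by move=> z [/sE].
- by move=> z [/cE]; rewrite /y kd.
- by have [z [Ez hz]] := Ec k kd; rewrite /y kd => tz; exists z.
Qed.

(** Pick a chart that meets the smallest member of the chain; it meets all the others,
    in dense open parts. *)
Lemma chain_independent W n (Z : nat -> set (zspace A)) : irreducible_chain W n Z ->
  exists i (f : nat -> mpoly (chart_dim i) K), Z n `&` chart_dom i !=set0 /\
    indep (fun z l => ev (coord i z) (f l)) n (Z n `&` chart_dom i).
Proof.
move=> [iZ sZ]; have [[[z0 Zz0] _] _] := iZ 0%N (leq0n n).
have [i uz0] := chart_cover AP z0; exists i.
have Zn l : (l <= n)%N -> Z l z0.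
  by elim: l => // l IH ln; apply: (sZ l ln).1; apply: IH; apply: ltnW.
have /choice[f fP] : forall l, exists f : mpoly (chart_dim i) K, (l < n)%N ->
    (forall z, Z l z -> chart_dom i z -> ev (coord i z) f = 0) /\
    exists2 z, (Z l.+1 `&` chart_dom i) z & ev (coord i z) f != 0.
  move=> l; have [ln|] := boolP (l < n)%N; last by exists 0.
  have [_ [F cF ZF]] := iZ l (ltnW ln); have [iZ' [F' cF' ZF']] := iZ l.+1 ln.
  have [|_ dns] := irreducible_open iZ' (chart_open AP i).
    by exists z0; split=> //; apply: Zn.
  have /existsNP[z /not_implyP[[Zz uz] nF]] : ~ (Z l.+1 `&` chart_dom i `<=` F).
    move=> /(dns F cF) ZlF; have [_ []] := sZ l ln; rewrite ZF => z Zz; split.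
      by move: Zz; rewrite ZF' => -[].
    exact: ZlF.
  have [S SP] := closed_trace i cF.
  move: nF; rewrite SP // => /existsNP[P /not_implyP[SP' /eqP nP]].
  exists P => _; split; last by exists z.
  by move=> z'; rewrite ZF => -[_ Fz'] uz'; apply: (SP z' uz').1.
exists f; split; first by exists z0; split=> //; apply: Zn.
apply: (@indep_of_chain _ _ _ n (fun l => Z l `&` chart_dom i)) => l ln.
- have pZ : prime_on (chart_dim i) (coord i) (Z l `&` chart_dom i).
    apply: (irreducible_prime AP (iZ l ln).1).
    by exists z0; split=> //; apply: Zn.
  apply: prime_on_transfer pZ => R.
  have [|Q QE] := @polyfn_comp K (chart_dim i) n R (fun l v => ev v (f l)).
    by move=> k _; apply: polyfn_ev.
  by exists Q => z _; rewrite -QE.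
- by move=> z [Zz uz]; split=> //; apply: (sZ l ln).1.
- by move=> z [Zz uz]; apply: (fP l ln).1.
- by have [_ [z Zz fz]] := fP l ln; exists z.
Qed.

End Chains.

Section ProductTopology.
Context {K : closedFieldType} {T1 T2 : choiceType} (A1 : atlas K T1) (A2 : atlas K T2).
Hypotheses (P1 : is_variety A1) (P2 : is_variety A2).

Lemma coord_prod (i : chart_index A1) (j : chart_index A2) (z : T1 * T2) k :
  (k < chart_dim i + chart_dim j)%N ->
  @coord _ _ (prod_atlas A1 A2) (i, j) z k = prod_coord (chart_dim i) (coord i) (coord j) z k.
Proof. exact: row_coord_mx. Qed.

Lemma ev_coord_prod (i : chart_index A1) (j : chart_index A2) (z : T1 * T2)
    (P : mpoly (chart_dim i + chart_dim j) K) :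
  ev (@coord _ _ (prod_atlas A1 A2) (i, j) z) P =
  ev (prod_coord (chart_dim i) (coord i) (coord j) z) P.
Proof. by apply: eq_ev => k; apply: coord_prod. Qed.

Lemma continuous_pair1 (x2 : T2) :
  continuous (fun x1 : zspace A1 => (x1, x2) : zspace (prod_atlas A1 A2)).
Proof.
apply/continuousP => W oW; apply: open_of_basis => i x1 u1 Wx.
have [j u2] := chart_cover P2 x2.
have [P [Px PW]] := @open_basis K _ (prod_atlas A1 A2) W (i, j) (x1, x2) oW Wx (conj u1 u2).
have [Q QE] := prod_coord1 (coord i) (coord j) P x2.
rewrite ev_coord_prod -QE in Px; exists Q; split=> // y uy.
by rewrite QE -ev_coord_prod => Qy; apply: PW Qy.
Qed.

Lemma continuous_pair2 (x1 : T1) :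
  continuous (fun x2 : zspace A2 => (x1, x2) : zspace (prod_atlas A1 A2)).
Proof.
apply/continuousP => W oW; apply: open_of_basis => j x2 u2 Wx.
have [i u1] := chart_cover P1 x1.
have [P [Px PW]] := @open_basis K _ (prod_atlas A1 A2) W (i, j) (x1, x2) oW Wx (conj u1 u2).
have [Q QE] := prod_coord2 (coord i) (coord j) P x1.
rewrite ev_coord_prod -QE in Px; exists Q; split=> // y uy.
by rewrite QE -ev_coord_prod => Qy; apply: PW Qy.
Qed.

End ProductTopology.

(** * Orbit maps *)

Section Orbits.
Context {K : closedFieldType} (G : algebraic_group K) (X : variety K).
Variable act : G -> X -> X.
Hypotheses (act_alg : algebraic_action act) (X_irr : irreducible_set [set: X]).

Let AG := ag_atlas G.
Let AX := vatlas X.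
Let PG : is_variety AG := ag_variety G.
Let PX : is_variety AX := vatlasP X.

Lemma continuous_act (g : G) : continuous (act g).
Proof.
move=> x; apply: (@continuous_comp _ (zspace (prod_atlas AG AX)) _
  (fun x : zspace AX => (g, x) : zspace (prod_atlas AG AX)) (fun gx => act gx.1 gx.2)).
  exact: continuous_pair2.
exact: (act_morphism act_alg).1.
Qed.

Lemma continuous_orbit (x : X) : continuous (fun g : zspace AG => act g x).
Proof.
move=> g; apply: (@continuous_comp _ (zspace (prod_atlas AG AX)) _
  (fun g : zspace AG => (g, x) : zspace (prod_atlas AG AX)) (fun gx => act gx.1 gx.2)).
  exact: (continuous_pair1 PX).
exact: (act_morphism act_alg).1.
Qed.

(** The image of the orbit map of [x] on the piece [Z] has dimension [d], as seen in
    the chart [t]. The dense subset [D] of [Z] carries at most [d] independent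
    functions of [g.x]. Every nonempty open part of [Z] contains a chain
    of [d.+1] irreducible sets with images separated by closed sets. *)
Definition orbit_rank_at (Z : set (zspace AG)) (t : chart_index AX) (d : nat) (x : X) :=
  exists D : set (zspace AG),
  [/\ forall g, D g -> chart_dom t (act g x),
      forall F : set (zspace AG), closed F -> D `<=` F -> Z `<=` F,
      forall k (f : nat -> mpoly (chart_dim t) K),
        indep (fun g l => ev (coord t (act g x)) (f l)) k D -> (k <= d)%N &
      forall Om : set (zspace AG), open Om -> Z `&` Om !=set0 ->
        exists (E : nat -> set (zspace AG)) (C : nat -> set X),
          (forall k, (k <= d)%N -> irreducible_set (E k) /\ E k `<=` Z `&` Om) /\
          forall k, (k < d)%N -> [/\ E k `<=` E k.+1, closed (C k),
            forall g, E k g -> C k (act g x) & exists2 g, E k.+1 g & ~ C k (act g x)]].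

(** Near a point where [g.x] lies in the chart [t], its coordinates are quotients of
    polynomials in the coordinates of [g] and [x], to which [generic_rank] applies. *)
Lemma generic_orbit_rank (a : chart_index AG) (Z : set (zspace AG)) (c t : chart_index AX) :
  Z `<=` chart_dom a -> prime_on (chart_dim a) (coord a) Z ->
  closed_on (chart_dim a) (coord a) Z ->
  (exists g x, [/\ Z g, chart_dom c x & chart_dom t (act g x)]) ->
  exists d (O : set X), [/\ open O, O !=set0, O `<=` chart_dom c &
    forall x, O x -> orbit_rank_at Z t d x].
Proof.
move=> Za pZ cZ [g0 [x0 [Zg0 cx0 tx0]]].
pose PA := prod_atlas AG AX.
pose actp (gx : zspace PA) : zspace AX := act gx.1 gx.2.
have [act_cont act_reg] := act_morphism act_alg.
have oW : open (actp @^-1` (chart_dom t : set (zspace AX))).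
  by move/continuousP: act_cont; apply; apply: chart_open.
have [|q [p [q0 qp]]] := @regular_quotient K _ PA (chart_dim t)
    (fun gx k => coord t (actp gx) k) _ (a, c) (g0, x0) oW tx0 (conj (Za _ Zg0) cx0).
  move=> k kt; apply: (act_reg (g0, x0) (fun z : zspace AX => coord t z k)).
  exact: coord_regular.
pose u := prod_coord (chart_dim a) (@coord _ _ AG a) (@coord _ _ AX c).
have pB : prime_on (chart_dim c) (@coord _ _ AX c) (chart_dom c).
  have := @irreducible_prime _ _ _ PX c _ X_irr; rewrite setTI; apply.
  by exists x0.
have qpu g x : Z g -> chart_dom c x -> ev (u (g, x)) q != 0 ->
    chart_dom t (act g x) /\ forall k, (k < chart_dim t)%N ->
      coord t (act g x) k * ev (u (g, x)) q = ev (u (g, x)) (p k).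
  move=> Zg cx; rewrite -ev_coord_prod => qz.
  have [h1 h2] := qp (g, x) (conj (Za _ Zg) cx) qz; split=> // k kt.
  by rewrite -ev_coord_prod h2.
have [||d [b [nb bP]]] := @generic_rank K _ _ _ _ (chart_dim t) (@coord _ _ AG a)
   (@coord _ _ AX c) (fun g x => coord t (act g x)) Z (chart_dom c) q p pZ pB.
- move=> /(_ (g0, x0) (conj Zg0 cx0)) /eqP; rewrite -ev_coord_prod.
  by rewrite (negbTE q0).
- by move=> g x Zg cx qz k kt; have [_] := qpu g x Zg cx qz; apply.
exists d, [set x | chart_dom c x /\ ev (coord c x) b != 0]; split.
- exact: open_principal.
- by have [x cx bx] := vanishN nb; exists x.
- by move=> x [].
move=> x [cx bx]; have [f0 frank [phi [phit phii]]] := bP x cx bx.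
set D := fiber _ _ _ _ _ in f0 frank phii.
have [qx qxE] := prod_coord1 (@coord _ _ AG a) (@coord _ _ AX c) q x.
have DE : D = [set g | Z g /\ ev (coord a g) qx != 0].
  by apply/seteqP; split=> g /=; rewrite /D /fiber /= qxE.
have iZ := prime_irreducible Za pZ.
have dns (F : set (zspace AG)) : closed F -> D `<=` F -> Z `<=` F.
  move=> cF DF; have [|_] := irreducible_open iZ (open_principal PG (i := a) qx).
    have [g] := f0; rewrite DE => -[Zg qg]; exists g; split=> //; split=> //.
    exact: Za.
  by apply=> // g [Zg [_ qg]]; apply: DF; rewrite DE.
exists D; split=> //; first by move=> g [Zg qg]; have [] := qpu g x Zg cx qg.
move=> Om oOm [g' [Zg' Omg']].
have [g1 [Dg1 Omg1]] : exists g, D g /\ Om g.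
  apply: contrapT => no; have [] // : (~` Om) g'.
  apply: (dns _ (open_closedC oOm)) => // g Dg Og.
  by apply: no; exists g.
have Zg1 : Z g1 by case: Dg1.
have [P [P1 PO]] := open_basis oOm Omg1 (Za _ Zg1).
have /choice[px pxE] : forall k, exists R : mpoly (chart_dim a) K, forall g,
    ev (coord a g) R = ev (u (g, x)) (p (phi k)) by move=> k; apply: prod_coord1.
have [|||E [C [EP EC]]] := @fiber_chain K _ AG a Z qx P d
    (fun g k => coord t (act g x) (phi k)) px Za pZ cZ.
- move=> g; rewrite -[[set _ | _] g]/([set g | Z g /\ ev (coord a g) qx != 0] g) -DE.
  move=> [Zg qg] k kd; rewrite qxE pxE; have [_] := qpu g x Zg cx qg; apply.
  exact: phit.
- by rewrite -DE.
- by rewrite -DE; exists g1.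
have /choice[L LE] : forall k, exists L : mpoly (chart_dim t) K, (k < d)%N ->
    forall v, ev v L = v (phi k) - C k.
  move=> k; have [kd|] := boolP (k < d)%N; last by exists 0.
  exists (mpolyX K (mnm1 (Ordinal (phit k kd))) - mpolyC _ (C k)) => _ v.
  by rewrite rmorphB /= evX evC.
exists E, (fun k => [set z | chart_dom t z -> ev (coord t z) (L k) = 0]); split.
  move=> k kd; have [iE ED] := EP k kd; split=> // g /ED[[Zg qg] Pg]; split=> //.
  by apply: PO => //; apply: Za.
move=> k kd; have [sE Ec [g Eg gc]] := EC k kd; split=> //.
- exact: closed_principal.
- by move=> g2 /Ec e _; rewrite LE // e subrr.
- exists g => // Cg; have [_ /(_ g Eg)[[Zg qg] _]] := EP k.+1 kd.
  have tg : chart_dom t (act g x) by have [] := qpu g x Zg cx; rewrite -?qxE.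
  by have /eqP := Cg tg; rewrite LE // subr_eq0 (negbTE gc).
Qed.

End Orbits.

(** * Generic orbits and modality *)

Section Modality.
Context {K : closedFieldType} (G : algebraic_group K) (X : variety K).
Variable act : G -> X -> X.
Hypotheses (act_alg : algebraic_action act) (X_irr : irreducible_set [set: X]).

Let AG := ag_atlas G.
Let AX := vatlas X.
Let PG : is_variety AG := ag_variety G.
Let PX : is_variety AX := vatlasP X.

Lemma actK g x : act g^-1%g (act g x) = x.
Proof. by rewrite -(actionM act_alg) mulVg (action1 act_alg). Qed.

Lemma actVK g x : act g (act g^-1%g x) = x.
Proof. by rewrite -(actionM act_alg) mulgV (action1 act_alg). Qed.

Lemma open_meet (U V : set X) : open U -> open V -> U !=set0 -> V !=set0 -> U `&` V !=set0.
Proof.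
move=> oU oV [u Uu] V0; have [|_ dns] := irreducible_open X_irr oV; first by rewrite setTI.
apply: contrapT => no; have [] // : (~` U) u.
apply: (dns _ (open_closedC oU)) => // v [_ Vv] Uv.
by apply: no; exists v.
Qed.

Lemma finite_open_meet (J : finType) (O : J -> set X) :
  (forall j, open (O j)) -> (forall j, O j !=set0) ->
  open [set x | forall j, O j x] /\ [set x | forall j, O j x] !=set0.
Proof.
move=> oO O0; split.
  rewrite -closedC (_ : ~` _ = \bigcup_(j in [set: J]) ~` O j).
    by apply: closed_bigcup => [|j _]; [exact: finite_finset|exact: open_closedC].
  apply/seteqP; split=> x /=; first by move=> /existsNP[j nO]; exists j.
  by move=> [j _ nO] /(_ j).
apply: contrapT => no; have [x|j /(_ _ I) nO] := irreducible_finite_cover X_irr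
    (F := fun j => ~` O j) (fun j => open_closedC (oO j)).
  move=> _; apply: contrapT => /forallNP nO; apply: no; exists x => j.
  by apply: contrapT => /nO.
by have [x Ox] := O0 j; apply: (nO x).
Qed.

(** A chain in [X] gives independent functions on some chart, and slicing that chart by
    these functions gives a chain of the same length inside [V]. *)
Lemma dense_chain (W V : set X) n (Z : nat -> set X) : open V -> V !=set0 -> V `<=` W ->
  irreducible_chain [set: X] n Z -> exists Z' : nat -> set X, irreducible_chain W n Z'.
Proof.
move=> oV V0 VW /(chain_independent PX)[i [f [[z [_ uz]] find]]].
have [x [Vx ux]] := open_meet oV (chart_open PX i) V0 (ex_intro _ z uz).
have [P [Px PV]] := open_basis oV Vx ux.
have pB : prime_on (chart_dim i) (coord i) (chart_dom i).
  have := @irreducible_prime _ _ _ PX i _ X_irr; rewrite setTI; apply.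
  by exists x.
have [|||E [C [EP EC]]] := @fiber_chain K _ AX i (chart_dom i) 1 P n
    (fun z l => ev (coord i z) (f l)) f (fun z uz => uz) pB (closed_on_dom PX (i := i)).
- by move=> y _ k _; rewrite rmorph1 mulr1.
- move=> Q vQ; apply: find => y [_ uy]; apply: vQ; split=> //.
  by rewrite rmorph1 oner_neq0.
- by exists x => //; split=> //; rewrite rmorph1 oner_neq0.
exists (fun k => W `&` closure (E k)).
apply: (@chain_of_separated _ W n E (fun k => [set y | chart_dom i y ->
    ev (coord i y) (f k - mpolyC _ (C k)) = 0])) => k kn.
- have [iE ED] := EP k kn; split=> // y /ED[[uy _] Py]; apply: VW; exact: PV.
- by have [] := EC k kn.
- have [_ Ec [y Ey yc]] := EC k kn; split; first exact: closed_principal.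
    by move=> y' /Ec /= e _; rewrite rmorphB /= evC e subrr.
  have [_ /(_ y Ey)[[uy _] _]] := EP k.+1 kn.
  by move=> /(_ y Ey uy) /eqP; rewrite rmorphB /= evC subr_eq0 (negbTE yc).
Qed.

(** The group is covered by finitely many pieces [Z j] and [X] by finitely many charts
    [t]. For every pair [(j, t)] such that some [g.x] lies in [t], the generic rank
    [r (j, t)] is defined; [d] is the largest of them, attained at [pm]. An
    irreducible subset of an orbit lies in the closure of the orbit of one
    piece, which bounds the length of chains. To obtain a chain of length [d]
    near [x] itself, the piece of [pm] is moved by the inverse of one of its
    elements [g], so that its image passes through [x]. *)
Lemma generic_orbit_dim : exists (d : nat) (O : set X), [/\ open O, O !=set0,
  forall x k (W : set X) (Z : nat -> set X), O x -> W `<=` group_orbit act x ->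
    irreducible_chain W k Z -> (k <= d)%N &
  forall x (U : set X), O x -> open U -> U x -> exists Z0 : set X,
    [/\ irreducible_set Z0, Z0 x, Z0 `<=` U `&` group_orbit act x &
     forall W, Z0 `<=` W -> exists Z : nat -> set X, irreducible_chain W d Z]].
Proof.
have [J [ij [Z [ZP Zc]]]] := variety_pieces PG.
have [[x00 _] _] := X_irr; have [c cx00] := chart_cover PX x00.
pose good (p : J * chart_index AX) :=
  exists g x, [/\ Z p.1 g, chart_dom c x & chart_dom p.2 (act g x)].
have /choice[r /choice[O OP]] : forall p, exists (d : nat) (O : set X),
    [/\ open O, O !=set0, O `<=` chart_dom c &
    good p -> forall x, O x -> orbit_rank_at act (Z p.1) p.2 d x].
  move=> p; have [gp|ngp] := pselect (good p).
    have [Zi pZ cZ] := ZP p.1.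
    have [d [O [oO O0 Oc OP]]] := generic_orbit_rank act_alg X_irr Zi pZ cZ gp.
    by exists d, O.
  exists 0%N, (chart_dom c); split=> //; first exact: (chart_open PX c).
  by exists x00.
have [oX1 X10] := finite_open_meet (fun p => let: And4 h _ _ _ := OP p in h)
  (fun p => let: And4 _ h _ _ := OP p in h).
have [j1 Zj1] := Zc 1%g.
have good1 : good (j1, c) by exists 1%g, x00; rewrite (action1 act_alg).
pose pm := [arg max_(p > (j1, c) | `[< good p >]) r p].
have [gpm rmax] : good pm /\ forall p, good p -> (r p <= r pm)%N.
  rewrite /pm; case: arg_maxnP; first exact/asboolP.
  by move=> p /asboolP gp pmax; split=> // p' gp'; apply: pmax; apply/asboolP.
exists (r pm), [set x | forall p, O p x]; split=> //.
  move=> x k W Zk Ox Wx ch; have [iZ sZ] := ch.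
  have [iZk _] := iZ k (leqnn k).
  have ZkW : Zk k `<=` W by have [_ [F _ ->]] := iZ k (leqnn k) => y [].
  have [z /ZkW/Wx[g _ <-]|j Zkj] := irreducible_finite_cover iZk
      (F := fun j => closure [set act g x | g in Z j]) (fun j => @closed_closure _ _).
    by have [j Zg] := Zc g; exists j; apply: subset_closure; exists g.
  have [t [f [[z [Zkz tz]] find]]] := chain_independent PX ch.
  have [y [[g Zg gy] ty]] : exists y, [set act g x | g in Z j] y /\ chart_dom t y.
    have [|y [? ?]] := Zkj z Zkz (chart_dom t); last by exists y.
    by apply: open_nbhs_nbhs; split=> //; apply: chart_open.
  have gp : good (j, t).
    exists g, x; split=> //; last by rewrite gy.
    by have [_ _ Oc _] := OP (j, t); apply: Oc.
  apply: leq_trans (rmax _ gp).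
  have [_ _ _ /(_ gp x (Ox _))[D [Dt dns rank _]]] := OP (j, t).
  apply: rank => P vP; apply: find => z' [Zz' tz'].
  have [Q QE] : polyfn (chart_dim t) (fun v => ev (fun l => ev v (f l)) P).
    by apply: (polyfn_comp P (r := fun l v => ev v (f l))) => l _; apply: polyfn_ev.
  have cQ : closed [set y' : X | chart_dom t y' -> ev (coord t y') Q = 0].
    exact: closed_principal.
  suff AQ : [set act g x | g in Z j] `<=` [set y' | chart_dom t y' -> ev (coord t y') Q = 0].
    by rewrite QE; apply: (closure_sub cQ AQ (Zkj z' Zz')).
  move=> _ [g' Zg' <-]; move: g' Zg'.
  apply: (dns [set g' | chart_dom t (act g' x) -> ev (coord t (act g' x)) Q = 0]).
    have /continuous_closedP cont := continuous_orbit act_alg (x := x).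
    exact: (cont _ cQ).
  by move=> g' Dg' _; rewrite -QE; apply: vP.
move=> x U Ox oU Ux.
have [_ _ _ /(_ gpm x (Ox _))[D [Dt dns _ low]]] := OP pm.
have [Zi pZ cZ] := ZP pm.1; have [g Zg] := pZ.1.
(* Translated so that [g] is sent to [x]. *)
pose phi g' := act g^-1%g (act g' x).
have phic : continuous (phi : zspace AG -> X).
  move=> g'; apply: (@continuous_comp _ _ _ (fun g' : zspace AG => act g' x) (act g^-1%g)).
    exact: continuous_orbit.
  exact: continuous_act.
pose Om : set (zspace AG) := phi @^-1` U.
have oOm : open Om by move/continuousP: phic; apply.
have Omg : Om g by rewrite /Om /= /phi actK.
have ZOm : Z pm.1 `&` Om !=set0 by exists g.
have [E [C [EP EC]]] := low Om oOm ZOm.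
have [iZOm _] := irreducible_open (prime_irreducible Zi pZ) oOm ZOm.
exists (phi @` (Z pm.1 `&` Om)); split.
- exact: irreducible_image.
- by exists g; rewrite // /phi actK.
- move=> _ [g' [_ Og'] <-]; split=> //; exists (g^-1 * g')%g => //.
  by rewrite (actionM act_alg).
move=> W ZW; exists (fun k => W `&` closure (phi @` E k)).
apply: (@chain_of_separated _ W _ (fun k => phi @` E k) (fun k => act g @^-1` C k)) => k kd.
- have [iE ED] := EP k kd; split; first exact: irreducible_image.
  by move=> _ [g' /ED Eg' <-]; apply: ZW; exists g'.
- have [sE _ _ _] := EC k kd; by move=> _ [g' /sE Eg' <-]; exists g'.
- have [_ cC EC1 [g' Eg' nC]] := EC k kd; split.
  + by have /continuous_closedP cont := continuous_act act_alg (g := g); apply: cont.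
  + by move=> _ [g2 /EC1 h <-]; rewrite /= /phi actVK.
  + move=> /(_ (phi g')) H; apply: nC.
    by have := H (ex_intro2 _ _ g' Eg' erefl); rewrite /= /phi actVK.
Qed.

End Modality.

Theorem theorem4p1 (K : closedFieldType) (G : algebraic_group K)
    (X : variety K) (act : G -> X -> X) (act_alg : algebraic_action act)
    (X_irr : irreducible_set [set: X]) :
  exists X1 : set X, [/\ open X1, dense X1 &
    forall x : X, X1 x ->
      (krull_dim [set: X] - krull_dim (group_orbit act x) <= modality act x)%E].
Proof.
have [d [O [oO O0 up low]]] := generic_orbit_dim act_alg X_irr.
exists O; split=> //.
  by move=> V V0 oV; apply: (open_meet X_irr).
have stratum y (U : set X) : O y -> open U -> U y -> orbit_stratum act U d y.
  move=> Oy oU Uy; split=> //.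
  have [Z0 [iZ0 Z0y Z0U ch]] := low y U Oy oU Uy.
  have [Z [iZ ZU Zmax] Z0Z] := irreducible_component_ex iZ0 Z0U.
  have dimZ Z' : Z' `<=` U `&` group_orbit act y -> forall k (Zk : nat -> set X),
      irreducible_chain Z' k Zk -> (k <= d)%N.
    by move=> Z'U k Zk; apply: (up y) => // z /Z'U[].
  apply: supremum_max.
    exists Z; first by split=> //; apply: Z0Z.
    by have [Zk /krull_dim_eq] := ch Z Z0Z; apply; apply: dimZ.
  move=> _ [Z' [[iZ' Z'U _] _] <-].
  apply: supremum_le.
    have [z Zz] := iZ'.1; exists 0%:Z%:E, 0%N => //; exists (fun=> Z').
    split=> // k; rewrite leqn0 => /eqP _; split=> //; exists setT; first exact: closedT.
    by rewrite setIT.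
  move=> _ [k [Zk ch'] <-]; rewrite lee_fin lez_nat.
  exact: dimZ ch'.
move=> x Ox; apply: le_infimum.
  by exists (modality_on act setT), setT => //; split=> //; exact: openT.
move=> _ [U [oU Ux] <-].
apply: (@le_trans _ _ (krull_dim (orbit_stratum act U d) - d%:Z%:E)%E); last first.
  by apply: supremum_ub; exists d.
apply: leeB.
  apply: krull_dim_le => n Z; apply: (dense_chain X_irr (V := U `&` O)).
  - exact: openI.
  - by exists x.
  - by move=> y [Uy Oy]; apply: stratum.
have [Z0 [iZ0 Z0x Z0U ch]] := low x U Ox oU Ux.
have [|Z] := ch (group_orbit act x); first by move=> z /Z0U[].
exact: krull_dim_ge.
Qed.
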